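(* Let $M\subset\mathbb{R}^{n+m}$ be a smooth, compact, embedded $n$-dimensional submanifold without boundary, and let $k\ge 2$ be an integer. Then at every point of $M$ the following estimate holds: $$|A^k|^2\ge C_k\,|\mathrm{B}|^{2k-4},$$ where $C_k>0$ is a universal constant depending only on $k$, $n$ and $m$.
   Context: Let $d^M(x)=\inf_{y\in M}|x-y|$ and $A^M(x)=\frac{|x|^2-[d^M(x)]^2}{2}$, which is smooth in an open neighbourhood of $M$ in $\mathbb{R}^{n+m}$. For $x\in M$ and $X_i=X_i^je_j\in\mathbb{R}^{n+m}$ (with $e_1,\dots,e_{n+m}$ the canonical basis), $A^k(x)(X_1,\dots,X_k)=\frac{\partial^kA^M(x)}{\partial x_{i_1}\cdots\partial x_{i_k}}X_1^{i_1}\cdots X_k^{i_k}$ (sum over repeated indices), and $|A^k|^2=\sum_{1\le i_1,\dots,i_k\le n+m}[A^k(e_{i_1},\dots,e_{i_k})]^2$ (the same value for any orthonormal basis). The second fundamental form is $\mathrm{B}(X,Y)=\left(\frac{\partial Y}{\partial X}\right)^\perp$ for $X,Y\in T_xM$ ($Y$ extended to a local tangent field, $\perp$ the projection on the normal space), extended to all $V,W\in\mathbb{R}^{n+m}$ by first projecting them on $T_xM$; $|\mathrm{B}|^2=\sum_{i,j,l}\langle\mathrm{B}(e_i,e_j),e_l\rangle^2$. For $k=2$, $|\mathrm{B}|^0$ is understood as $1$. *)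

(* Defs.v *)
From mathcomp Require Import all_boot all_order all_algebra.
From mathcomp Require Export boolp classical_sets reals topology normedtype derive.

Set Implicit Arguments.
Unset Strict Implicit.
Unset Printing Implicit Defensive.

Import Order.TTheory GRing.Theory Num.Theory.
Import numFieldNormedType.Exports.

Local Open Scope classical_set_scope.
Local Open Scope ring_scope.

Section Smoothness.
Context {R : realType} {V W : normedModType R}.

(* iter_derive [:: v_1; ...; v_k] f = D_{v_1} (D_{v_2} ... (D_{v_k} f)).
   The library's 'D_v is total: it is the genuine directional derivative
   wherever f is differentiable. *)
Definition iter_derive (vs : seq V) (f : V -> W) : V -> W :=
  foldr (fun v (g : V -> W) x => 'D_v g x) f vs.

(* C^oo on U (meant for U open): f and all its iterated directional
   derivatives are (Frechet) differentiable, hence also continuous, on U. *)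
Definition smooth_on (U : set V) (f : V -> W) : Prop :=
  forall (vs : seq V) (x : V), U x -> differentiable (iter_derive vs f) x.

End Smoothness.

Section Euclidean.
Context {R : realType} {N : nat}.
Implicit Types u v : 'rV[R]_N.

(* The library's norm `|u| on 'rV[R]_N is the sup norm; it induces the usual
   topology, but distances and lengths below have to be Euclidean. *)
Definition dotv u v : R := \sum_(i < N) u 0 i * v 0 i.
Definition enorm u : R := Num.sqrt (dotv u u).

Definition basis_vec (i : 'I_N) : 'rV[R]_N := delta_mx 0 i.

End Euclidean.

(* M is a smooth embedded n-dimensional submanifold without boundary of
   R^(n+m): near each of its points a diffeomorphism Phi (with inverse Psi)
   between open subsets of R^(n+m) straightens M to R^n x {0}. *)
Definition embedded_submanifold (R : realType) (n m : nat)
    (M : set 'rV[R]_(n + m)) : Prop :=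
  forall x, M x ->
  exists (U V : set 'rV[R]_(n + m)) (Phi Psi : 'rV[R]_(n + m) -> 'rV[R]_(n + m)),
    [/\ open U, open V & U x] /\
    [/\ smooth_on U Phi, smooth_on V Psi,
        (forall y, U y -> V (Phi y) /\ Psi (Phi y) = y) &
        (forall z, V z -> U (Psi z) /\ Phi (Psi z) = z)] /\
    (forall y, U y -> (M y <-> rsubmx (Phi y) = 0)).

Section Geometry.
Context {R : realType} {N : nat}.
Variable M : set 'rV[R]_N.
Implicit Types (x y v w : 'rV[R]_N).

(* d^M *)
Definition dist_to x : R := inf [set enorm (x - y) | y in M].

(* A^M *)
Definition AM x : R := (enorm x ^+ 2 - dist_to x ^+ 2) / 2.

Definition AM_partial (k : nat) (i : k.-tuple 'I_N) x : R :=
  iter_derive [seq basis_vec j | j <- i] AM x.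

(* A^k(x)(X_1, ..., X_k) *)
Definition Ak (k : nat) x (X : k.-tuple 'rV[R]_N) : R :=
  \sum_(i : k.-tuple 'I_N)
     AM_partial i x * \prod_(j < k) (tnth X j) 0 (tnth i j).

(* |A^k|^2 *)
Definition Ak_sqnorm (k : nat) x : R :=
  \sum_(i : k.-tuple 'I_N) Ak x (map_tuple basis_vec i) ^+ 2.

(* v \in T_x M, as the velocity at 0 of a smooth curve in M through x *)
Definition tangent x v : Prop :=
  exists (I : set R) (c : R -> 'rV[R]_N),
    [/\ open I, I 0 & smooth_on I c] /\
    [/\ forall t, I t -> M (c t), c 0 = x & 'D_1 c 0 = v].

(* Orthogonal projections on T_x M and on its orthogonal complement; w is
   unique and exists since T_x M is a linear subspace when M is a submanifold
   and M x. *)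
Definition tangent_proj x v : 'rV[R]_N :=
  xget 0 [set w | tangent x w /\ forall u, tangent x u -> dotv (v - w) u = 0].
Definition normal_proj x v : 'rV[R]_N := v - tangent_proj x v.

(* Y is a tangent vector field on M near x, given as a smooth vector field on
   a neighbourhood of x in the ambient space that is tangent along M. *)
Definition local_tangent_field x (Y : 'rV[R]_N -> 'rV[R]_N) : Prop :=
  exists U : set 'rV[R]_N,
    [/\ open U, U x, smooth_on U Y & forall y, U y -> M y -> tangent y (Y y)].

(* B(v, w) for v, w in T_x M; the value does not depend on the extension Y
   of w. *)
Definition sff_tangent x v w : 'rV[R]_N :=
  xget 0 [set b | exists Y, [/\ local_tangent_field x Y, Y x = w &
                                b = normal_proj x ('D_v Y x)]].

(* B(v, w) for arbitrary v, w in the ambient space *)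
Definition sff x v w : 'rV[R]_N :=
  sff_tangent x (tangent_proj x v) (tangent_proj x w).

(* |B| *)
Definition sff_norm x : R :=
  Num.sqrt (\sum_(i < N) \sum_(j < N) \sum_(l < N)
              dotv (sff x (basis_vec i) (basis_vec j)) (basis_vec l) ^+ 2).

End Geometry.

(* Main.v *)
Require Import Defs.
From mathcomp Require Import all_boot all_order all_algebra.
From mathcomp Require Import boolp classical_sets functions reals topology normedtype landau derive.
From mathcomp Require Import zify ring lra.

Set Implicit Arguments.
Unset Strict Implicit.
Unset Printing Implicit Defensive.

Import Order.TTheory GRing.Theory Num.Theory.
Import numFieldNormedType.Exports.
Local Open Scope classical_set_scope.
Local Open Scope ring_scope.

(** Write A for A^M and N = n + m.  Since A(x) is the supremum over y in M of
    <x, y> - |y|^2 / 2, its gradient wherever the nearest point p(x) depends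
    continuously on x is p(x), so A^k is the (k-1)-st derivative of p.  The
    Hessian H = Dp is symmetric, at a point x0 of M it is the orthogonal
    projection P on the tangent space, and H(y) Y(y) = Y(y) for every tangent
    field Y along M.  Differentiating the last identity shows that
    B(v, w) = D_v (D_w p) (x0) for tangent v, w: the second fundamental form is
    a part of the third derivative A^3.

    For a normal vector nu put S = P (D_nu H)(x0) P, the shape operator in the
    direction nu.  A point y of M near x0 is the nearest point of
    y + t (nu - H(y) nu) for small t, because nu - H(y) nu is normal at y.
    Differentiating this in y at x0 gives (1 - t S) H(x0 + t nu) = P after
    composition with P; hence H(x0 + t nu) is the resolvent
    P + t S + t^2 S^2 + ... on the tangent space, and its j-th derivative at
    t = 0, an evaluation of A^(j+2) on j copies of nu, restricts to j! S^j there
    [projT_jet].  As S is symmetric, |S^j|^2 >= N^(1-j) |S|^(2j) for the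
    Frobenius norm, by log-convexity of j |-> |S^j|^2 [frob2_exp_ge].  With nu
    running through the projections of a basis on the normal space, the squares
    |S|^2 add up to at least |B|^2 [sff_norm_le], so one of them is at least
    |B|^2 / N, which gives the estimate with C = N^(-(2k-4)) [Ak_ge].

    What remains is that p is smooth near M.  A chart of M yields a tubular
    parametrization E of a neighbourhood of x0 with invertible derivative.  The
    nearest point exists by compactness, and together with the normal
    component it provides a right inverse Z of E near x0; E is injective with
    a Lipschitz inverse near its base point [local_injectivity], so Z is
    Lipschitz, hence differentiable, hence smooth because its derivative is a
    smooth function of Z itself [smooth_inverse].  The existence half of the
    inverse function theorem is thus replaced by the existence of minimizers. *)

(** * Smooth functions *)

Section Locality.
Context {R : realType} {V W : normedModType R}.
Implicit Types (U : set V) (f g : V -> W).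

Lemma near_eq_differentiable f g x :
  {near x, f =1 g} -> differentiable f x -> differentiable g x.
Proof.
move=> fg df.
have fgx : f x = g x by exact: nbhs_singleton fg.
have gE : g \o shift x = cst (g x) + 'd f x +o_ 0 id.
  apply/eqaddoP => e e0.
  have /eqaddoP /(_ e e0) := diff_locally df.
  move: fg; rewrite (near_shift 0 x) => fg.
  apply: filterS2 fg => y /=; rewrite subr0 => fgy.
  by rewrite /= !fctE/= fgy fgx.
have dg : 'd g x = 'd f x :> (V -> W).
  by apply: diff_unique gE; exact: diff_continuous.
by apply/diff_locallyP; rewrite dg; split=> //; exact: diff_continuous.
Qed.

Lemma open_eq_near U f g x : open U -> U x -> {in U, f =1 g} -> {near x, f =1 g}.
Proof.
move=> oU Ux fg; apply: filterS (open_nbhs_nbhs (conj oU Ux)) => y Uy.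
by apply: fg; rewrite inE.
Qed.

Lemma derive_eq_on U f g v : open U -> {in U, f =1 g} -> {in U, 'D_v f =1 'D_v g}.
Proof.
move=> oU fg x /[!inE] Ux; apply: near_eq_derive; exact: open_eq_near fg.
Qed.

(** The head of the list is the outermost derivative; smoothness is inherited
    through the innermost one, which is the last entry. *)
Lemma iter_derive_rcons (vs : seq V) v f :
  iter_derive (rcons vs v) f = iter_derive vs ('D_v f).
Proof. by rewrite /iter_derive foldr_rcons. Qed.

Lemma iter_derive_eq_on U f g vs :
  open U -> {in U, f =1 g} -> {in U, iter_derive vs f =1 iter_derive vs g}.
Proof. by move=> oU fg; elim: vs => //= v vs IH; exact: derive_eq_on. Qed.

Lemma smooth_on_eq U f g : open U -> {in U, f =1 g} -> smooth_on U f -> smooth_on U g.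
Proof.
move=> oU fg sf vs x Ux; apply: near_eq_differentiable (sf vs x Ux).
by apply: open_eq_near Ux _ => //; exact: iter_derive_eq_on.
Qed.

Lemma smooth_on_derive U f v : smooth_on U f -> smooth_on U ('D_v f).
Proof. by move=> sf vs x Ux; rewrite -iter_derive_rcons; exact: sf. Qed.

Lemma smooth_on_sub U U' f : U' `<=` U -> smooth_on U f -> smooth_on U' f.
Proof. by move=> UU sf vs x /UU; exact: sf. Qed.

Lemma smooth_on_diff U f x : smooth_on U f -> U x -> differentiable f x.
Proof. by move=> sf Ux; exact: (sf [::]). Qed.

Lemma derive_scale f x (a : R) u : differentiable f x ->
  'D_(a *: u) f x = a *: 'D_u f x.
Proof. by move=> df; rewrite !deriveE// linearZ. Qed.

Lemma derive_suml f x I (r : seq I) (a : I -> R) (u : I -> V) : differentiable f x ->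
  'D_(\sum_(i <- r) a i *: u i) f x = \sum_(i <- r) a i *: 'D_(u i) f x.
Proof.
move=> df; rewrite deriveE// linear_sum; apply: eq_bigr => i _.
by rewrite linearZ deriveE.
Qed.
End Locality.

Section CkDef.
Context {R : realType} {V : normedModType R}.
Implicit Types (U : set V) (f g : V -> R).

(** Finite order of smoothness, so that closure properties can be proved by
    induction on the order: differentiating a product or a composite brings
    back the original functions, for which the previous order is at hand. *)
Fixpoint Ck (k : nat) U f : Prop :=
  if k is k'.+1 then (forall x, U x -> differentiable f x) /\ (forall v, Ck k' U ('D_v f))
  else True.

Lemma smooth_onP U f : smooth_on U f <-> forall k, Ck k U f.
Proof.
split=> [sf k|Cf vs].
  elim: k f sf => //= k IH f sf; split; first by move=> x; exact: smooth_on_diff.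
  by move=> v; apply/IH/smooth_on_derive.
have {Cf} := Cf (size vs).+1.
elim/last_ind: vs f => [|vs v IH] f; first by case.
by rewrite iter_derive_rcons size_rcons => -[_ Cf]; exact: IH.
Qed.

Lemma smooth_on_Ck k U f : smooth_on U f -> Ck k U f.
Proof. by move=> /smooth_onP; apply. Qed.

Lemma Ck_eq k U f g : open U -> {in U, f =1 g} -> Ck k U f -> Ck k U g.
Proof.
move=> oU; elim: k f g => //= k IH f g fg [df Cf]; split=> [x Ux|v].
  by apply: near_eq_differentiable (df x Ux); exact: open_eq_near fg.
by apply: IH (Cf v); exact: derive_eq_on.
Qed.

Lemma CkS k U f : Ck k.+1 U f -> Ck k U f.
Proof. elim: k f => //= k IH f [df Cf]; split=> // v; exact/IH/Cf. Qed.

Lemma Ck_cst k U c : open U -> Ck k U (cst c).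
Proof.
move=> oU; elim: k c => //= k IH c; split=> [x _|v]; first exact: differentiable_cst.
by apply: Ck_eq (IH 0) => // x _; rewrite derive_cst.
Qed.

Lemma Ck_add k U f g : open U -> Ck k U f -> Ck k U g -> Ck k U (fun x => f x + g x).
Proof.
move=> oU; elim: k f g => //= k IH f g [df Cf] [dg Cg]; split=> [x Ux|v].
  by apply: differentiableD; [exact: df|exact: dg].
apply: Ck_eq (IH _ _ (Cf v) (Cg v)) => // x /[!inE] Ux.
by rewrite deriveD//; apply: diff_derivable; [exact: df|exact: dg].
Qed.

Lemma Ck_mul k U f g : open U -> Ck k U f -> Ck k U g -> Ck k U (fun x => f x * g x).
Proof.
move=> oU; elim: k f g => //= k IH f g Cf0 Cg0.
have [df Cf] := Cf0; have [dg Cg] := Cg0.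
split=> [x Ux|v]; first by apply: differentiableM; [exact: df|exact: dg].
have C1 := IH _ _ (@CkS k _ _ Cf0) (Cg v).
have C2 := IH _ _ (@CkS k _ _ Cg0) (Cf v).
apply: Ck_eq (Ck_add oU C1 C2) => // x /[!inE] Ux.
by rewrite deriveM//; apply: diff_derivable; [exact: df|exact: dg].
Qed.

Lemma Ck_inv k U f : open U -> (forall x, U x -> f x != 0) -> Ck k U f ->
  Ck k U (fun x => (f x)^-1).
Proof.
move=> oU f0; elim: k f f0 => //= k IH f f0 Cf0; have [df Cf] := Cf0.
split=> [x Ux|v]; first by apply: differentiableV; [exact: df|exact: f0].
have C1 := IH _ f0 (@CkS k _ _ Cf0).
have C2 := Ck_mul oU C1 C1.
have C3 := Ck_mul oU (Ck_mul oU C2 (Cf v)) (Ck_cst k (-1) oU).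
apply: Ck_eq C3 => // x /[!inE] Ux.
rewrite deriveV ?f0//; last by apply: diff_derivable; exact: df.
by rewrite /cst mulrN1 scaleNr /GRing.scale/= expr2 invfM.
Qed.

Lemma Ck_sum k U I (r : seq I) (P : pred I) (F : I -> V -> R) : open U ->
  (forall i, Ck k U (F i)) -> Ck k U (fun x => \sum_(i <- r | P i) F i x).
Proof.
move=> oU CF; elim: r => [|i r IH].
  by apply: Ck_eq (Ck_cst k 0 oU) => // x _; rewrite big_nil.
have [Pi|Pi] := boolP (P i).
  apply: Ck_eq (Ck_add oU (CF i) IH) => // x _; by rewrite big_cons Pi.
by apply: Ck_eq IH => // x _; rewrite big_cons (negbTE Pi).
Qed.

Lemma Ck_prod k U I (r : seq I) (F : I -> V -> R) : open U ->
  (forall i, Ck k U (F i)) -> Ck k U (fun x => \prod_(i <- r) F i x).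
Proof.
move=> oU CF; elim: r => [|i r IH].
  by apply: Ck_eq (Ck_cst k 1 oU) => // x _; rewrite big_nil.
apply: Ck_eq (Ck_mul oU (CF i) IH) => // x _; by rewrite big_cons.
Qed.

Lemma Ck_det k U n (F : V -> 'M[R]_n) : open U ->
  (forall i j, Ck k U (fun x => F x i j)) -> Ck k U (fun x => \det (F x)).
Proof.
move=> oU CF; apply: Ck_sum => // s; apply: Ck_mul => //; first exact: Ck_cst.
by apply: Ck_prod => // i; exact: CF.
Qed.

(** Cramer's rule makes the inverse a quotient of polynomials in the entries. *)
Lemma Ck_invmx k U n (F : V -> 'M[R]_n) i j : open U ->
  (forall i j, Ck k U (fun x => F x i j)) -> (forall x, U x -> F x \in unitmx) ->
  Ck k U (fun x => invmx (F x) i j).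
Proof.
move=> oU CF uF.
have C1 : Ck k U (fun x => (\det (F x))^-1).
  apply: Ck_inv => //; last exact: Ck_det.
  by move=> x /uF; rewrite unitmxE unitfE.
have C2 : Ck k U (fun x => \adj (F x) i j).
  apply: (@Ck_eq _ _ (fun x => (-1) ^+ (j + i) * \det (row' j (col' i (F x))))) => //.
    by move=> x _; rewrite mxE.
  apply: Ck_mul => //; first exact: Ck_cst.
  apply: Ck_det => // a b.
  by apply: Ck_eq (CF (lift j a) (lift i b)) => // x _; rewrite !mxE.
apply: Ck_eq (Ck_mul oU C1 C2) => // x /[!inE] Ux.
by rewrite /invmx uF// [RHS]mxE.
Qed.
End CkDef.

Section Chain.
Context {R : realType}.

Lemma derive_chain {V W X : normedModType R} (g : V -> W) (f : W -> X) x v :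
  differentiable g x -> differentiable f (g x) ->
  'D_v (fun y => f (g y)) x = 'D_('D_v g x) f (g x).
Proof.
move=> dg df; rewrite !deriveE//; last exact: differentiable_comp.
by rewrite (_ : (fun y => f (g y)) = f \o g)// diff_comp.
Qed.

Lemma differentiable_rV {V : normedModType R} {N} (F : V -> 'rV[R]_N) x :
  (forall i, differentiable (fun y => F y 0 i) x) <-> differentiable F x.
Proof.
split=> [dF|dF i]; last first.
  by apply: (@differentiable_comp _ _ _ _ F (fun A : 'rV[R]_N => A 0 i)) => //; exact: differentiable_coord.
rewrite (_ : F = \sum_(i < N) (fun y => F y 0 i *: delta_mx 0 i)).
  by apply: differentiable_sum => i; apply: differentiableZl.
by apply/funext => y; rewrite fct_sumE {1}[F y]row_sum_delta.
Qed.

Lemma derive_rV {V : normedModType R} {N} (F : V -> 'rV[R]_N) x v i :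
  differentiable F x -> ('D_v F x) 0 i = 'D_v (fun y => F y 0 i) x.
Proof. by move=> dF; rewrite derive_mx ?mxE//; exact: diff_derivable. Qed.

Lemma derive_basis {W : normedModType R} {N} (f : 'rV[R]_N -> W) x (v : 'rV[R]_N) :
  differentiable f x -> 'D_v f x = \sum_(i < N) v 0 i *: 'D_(basis_vec i) f x.
Proof. by move=> df; rewrite {1}[v]row_sum_delta derive_suml. Qed.

Lemma Ck_comp {V : normedModType R} {N} k (U : set V) (W : set 'rV[R]_N)
   (f : 'rV[R]_N -> R) (g : V -> 'rV[R]_N) :
  open U -> (forall x, U x -> W (g x)) -> Ck k W f ->
  (forall i, Ck k U (fun x => g x 0 i)) -> Ck k U (fun x => f (g x)).
Proof.
move=> oU UW; elim: k f => //= k IH f [df Cf] Cg.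
have dg x : U x -> differentiable g x.
  by move=> Ux; apply/differentiable_rV => i; have [+ _] := Cg i; apply.
split=> [x Ux|v].
  by apply: (@differentiable_comp _ _ _ _ g f); [exact: dg|exact/df/UW].
have C1 i : Ck k U (fun x => 'D_(basis_vec i) f (g x)).
  by apply: (IH ('D_(basis_vec i) f)) => [|j]; [exact: Cf|exact: (@CkS _ _ k _ _ (Cg j))].
have C2 i : Ck k U (fun x => 'D_v (fun y => g y 0 i) x * 'D_(basis_vec i) f (g x)).
  by apply: Ck_mul => //; have [_] := Cg i; apply.
apply: Ck_eq (Ck_sum (index_enum 'I_N) predT oU C2) => // x /[!inE] Ux.
rewrite derive_chain ?derive_basis; [|exact/df/UW|exact: dg|exact/df/UW].
by apply: eq_bigr => i _; rewrite derive_rV//; exact: dg.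
Qed.

Lemma iter_derive_rV {V : normedModType R} {N} (U : set V) (F : V -> 'rV[R]_N) vs i :
  open U -> smooth_on U F ->
  forall x, U x -> iter_derive vs F x 0 i = iter_derive vs (fun y => F y 0 i) x.
Proof.
move=> oU; elim/last_ind: vs F => //= vs v IH F sF x Ux.
rewrite !iter_derive_rcons IH//; last exact: smooth_on_derive.
apply: (iter_derive_eq_on _ oU); last by rewrite inE.
by move=> y /[!inE] Uy; rewrite derive_rV//; exact: smooth_on_diff sF Uy.
Qed.

Lemma smooth_on_rV {V : normedModType R} {N} (U : set V) (F : V -> 'rV[R]_N) :
  open U -> (forall i, smooth_on U (fun x => F x 0 i)) <-> smooth_on U F.
Proof.
move=> oU; split=> [sF vs x Ux|sF i].
  have {}sF : forall i, smooth_on U (fun x => F x 0 i) by [].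
  elim/last_ind: vs F sF => [|vs v IH] F sF.
    by apply/differentiable_rV => i; exact: smooth_on_diff (sF i) Ux.
  rewrite iter_derive_rcons; apply: IH => i.
  apply: smooth_on_eq (smooth_on_derive v (sF i)) => // y /[!inE] Uy.
  rewrite derive_rV//; apply/differentiable_rV => j; exact: smooth_on_diff (sF j) Uy.
move=> vs x Ux.
have /differentiable_rV/(_ i) := sF vs x Ux.
apply: near_eq_differentiable; apply: open_eq_near Ux _ => // y /[!inE] Uy.
exact: (iter_derive_rV vs i oU sF Uy).
Qed.

Definition entry {V : normedModType R} {N} (F : V -> 'rV[R]_N) i x : R := F x 0 i.

Lemma smooth_entry {V : normedModType R} {N} (U : set V) (F : V -> 'rV[R]_N) i :
  open U -> smooth_on U F -> smooth_on U (entry F i).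
Proof. by move=> oU sF; exact: ((smooth_on_rV F oU).2 sF i). Qed.

(** Transposed Jacobian matrix: vectors are rows, so derivatives act on the
    right. *)
Definition jac {N} (F : 'rV[R]_N -> 'rV[R]_N) x : 'M[R]_N :=
  \matrix_(a, b) 'D_(basis_vec a) (entry F b) x.

Lemma derive_jac {N} (F : 'rV[R]_N -> 'rV[R]_N) x v : differentiable F x ->
  'D_v F x = v *m jac F x.
Proof.
move=> dF; have /differentiable_rV dFi := dF.
apply/rowP => i; rewrite derive_rV// derive_basis//.
by rewrite mxE; apply: eq_bigr => j _; rewrite mxE.
Qed.

Lemma near_line {V : normedModType R} (O : set V) (y v : V) : open O -> O y ->
  \forall t \near (0 : R), O (y + t *: v).
Proof.
move=> oO Oy.
have ct : (fun t : R => y + t *: v) @ (0 : R) --> y + (0 : R) *: v.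
  apply: cvgD; first exact: cvg_cst.
  by apply: cvgZr_tmp; exact: cvg_id.
by apply: ct; apply: open_nbhs_nbhs; split => //; rewrite scale0r addr0.
Qed.

Lemma is_derive_line {V W : normedModType R} (f : V -> W) (y u : V) (r : R) :
  differentiable f (y + r *: u) ->
  is_derive r 1 (fun t => f (y + t *: u)) ('D_u f (y + r *: u)).
Proof.
move=> df.
have dl : differentiable (fun t : R => y + t *: u) r.
  by apply: differentiableD => //; apply: differentiableZl.
apply: DeriveDef.
  by apply: diff_derivable; exact: (@differentiable_comp _ _ _ _ (fun t : R => y + t *: u) f).
rewrite derive_chain//; congr derive.
have dl' : differentiable ( *:%R^~ u : R -> V) r by exact: differentiableZl.
rewrite deriveD//; last exact: diff_derivable.
by rewrite derive_cst add0r deriveE// diffZl// diff_val scale1r.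
Qed.
End Chain.

(** * Mean values and symmetry of second derivatives *)

Section Schwarz.
Context {R : realType} {V : normedModType R}.
Implicit Types (f : V -> R) (x y u v : V).

Lemma mvt_line f y u : (forall r, 0 <= r <= 1 -> differentiable f (y + r *: u)) ->
  exists2 r, 0 < r < 1 & f (y + u) - f y = 'D_u f (y + r *: u).
Proof.
move=> df.
have [||r r01 E] := @MVT R (fun t => f (y + t *: u)) (fun t => 'D_u f (y + t *: u)) 0 1 ltr01.
- by move=> r /[!in_itv]/= /andP[r0 r1]; apply/is_derive_line/df; rewrite !ltW.
- apply: continuous_in_subspaceT => r /[!inE]/= /[!in_itv]/= r01.
  apply: differentiable_continuous; apply/derivable1_diffP.
  by have [] := is_derive_line (df r r01).
- exists r; first by move: r01; rewrite in_itv.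
  by move: E; rewrite scale1r scale0r addr0 subr0 mulr1.
Qed.

Lemma derive_shiftv {W : normedModType R} (f : V -> W) y u w : differentiable f (y + w) ->
  'D_u (fun z => f (z + w)) y = 'D_u f (y + w).
Proof.
move=> df; have ds : differentiable (fun z : V => z + w) y by apply: differentiableD.
rewrite (derive_chain u ds df) deriveD//.
by rewrite derive_id derive_cst addr0.
Qed.

Lemma differentiable_shiftv {W : normedModType R} (f : V -> W) y w :
  differentiable f (y + w) -> differentiable (fun z => f (z + w)) y.
Proof.
move=> df; have ds : differentiable (fun z : V => z + w) y by apply: differentiableD.
exact: (differentiable_comp ds df).
Qed.

(** The mean value theorem applied to y |-> f (y + s v) - f y turns the second
    difference into an increment of D_u f, to which the differentiability of
    D_u f at x applies.  The second difference is symmetric in u and v. *)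
Lemma second_difference (O : set V) f x u v : open O -> O x ->
  (forall y, O y -> differentiable f y) -> differentiable ('D_u f) x ->
  forall e, 0 < e -> \forall s \near (0 : R)^'+,
   `|(f (x + s *: u + s *: v) - f (x + s *: u) - (f (x + s *: v) - f x))
      - s ^+ 2 * 'D_v ('D_u f) x| <= e * s ^+ 2.
Proof.
move=> oO Ox df dg e e0.
set g := 'D_u f in dg *.
pose K : R := `|u| + `|v| + 1.
have K0 : 0 < K by rewrite ltr_wpDl// addr_ge0.
have eK0 : 0 < e / 2 / K by rewrite !divr_gt0.
have := diff_locally dg => /eqaddoP /(_ _ eK0) near1.
have near2 : \forall h \near (0:V), O (h + x).
  have : \forall z \near x, O z by exact: (open_nbhs_nbhs (conj oO Ox)).
  by rewrite (near_shift 0 x); apply: filterS => h /=; rewrite subr0.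
have [d /= d0 dO] := (nbhs_ballP _ _).1 (filterI near1 near2).
near=> s.
have s0 : 0 < s by near: s; exact: nbhs_right_gt.
have sd : s * K < d.
  by rewrite -ltr_pdivlMr//; near: s; apply: nbhs_right_lt; rewrite divr_gt0.
(* The corners and the mean value point all lie at x + a s u + b s v. *)
have small (a b : R) : 0 <= a <= 1 -> 0 <= b <= 1 ->
    [/\ O (x + a *: (s *: u) + b *: (s *: v)),
     `|a *: (s *: u) + b *: (s *: v)| <= s * K &
     `|g (x + a *: (s *: u) + b *: (s *: v)) - g x
        - 'd g x (a *: (s *: u) + b *: (s *: v))| <=
       e / 2 / K * `|a *: (s *: u) + b *: (s *: v)| ].
  move=> /andP[a0 a1] /andP[b0 b1].
  set h := a *: (s *: u) + b *: (s *: v).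
  have hK : `|h| <= s * K.
    rewrite (le_trans (ler_normD _ _))// !normrZ !ger0_norm ?(ltW s0)//.
    rewrite /K -addrA mulrDr lerD//.
      by rewrite -[leRHS]mul1r ler_pM// ?mulr_ge0// ?(ltW s0).
    rewrite mulrDr -[leLHS]addr0 lerD ?mulr1 ?(ltW s0)//.
    by rewrite -[leRHS]mul1r ler_pM// ?mulr_ge0// ?(ltW s0).
  have /dO[] : ball (0 : V) d h.
    by rewrite -ball_normE /= sub0r normrN (le_lt_trans hK).
  move=> D1 D2; have hx : x + a *: (s *: u) + b *: (s *: v) = h + x by rewrite -addrA addrC.
  split=> //; rewrite hx //; move: D1; by rewrite [X in _ - X]fctE opprD addrA.
have [|r /andP[r0 r1] E] := @mvt_line (fun y => f (y + s *: v) - f y) x (s *: u).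
  move=> r r01; apply: differentiableB.
    apply: differentiable_shiftv; apply: df.
    by have [|] := small r 1 r01; rewrite ?scale1r// ler01 lexx.
  apply: df; by have [|] := small r 0 r01; rewrite ?scale0r ?addr0// lexx ler01.
have r01 : 0 <= r <= 1 by rewrite !ltW.
have [|A1 A2 A3] := small r 1 r01; first by rewrite ler01 lexx.
have [|B1 B2 B3] := small r 0 r01; first by rewrite ler01 lexx.
rewrite scale1r in A1 A2 A3; rewrite !scale0r !addr0 in B1 B2 B3.
rewrite E.
set y := x + r *: (s *: u) in E *.
have dshift : differentiable (fun z => f (z + s *: v)) y by apply: differentiable_shiftv; exact: df.
rewrite deriveB; [|exact: diff_derivable|by apply/diff_derivable/df].
rewrite derive_shiftv; last exact: df.
rewrite !derive_scale; [|exact: df|exact: df].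
rewrite -scalerBr.
rewrite [X in _ - _ * X]deriveE//.
have -> : s *: ('D_u f (y + s *: v) - 'D_u f y) - s ^+ 2 * 'd g x v
  = s * ((g (y + s *: v) - g x - 'd g x (r *: (s *: u) + s *: v)) -
         (g y - g x - 'd g x (r *: (s *: u)))).
  have dv : 'd g x (s *: v) = s * 'd g x v by rewrite linearZ.
  by rewrite [X in _ - X - _]linearD dv /g /GRing.scale/=; ring.
rewrite normrM gtr0_norm// expr2 [leRHS]mulrCA ler_pM2l//.
rewrite (le_trans (ler_normB _ _))// (le_trans (lerD A3 B3))//.
rewrite -mulrDr (le_trans (ler_wpM2l (ltW eK0) (lerD A2 B2)))//.
rewrite [leLHS](_ : _ = e * s)//; field; exact: lt0r_neq0.
Unshelve. all: by end_near. Qed.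

Theorem derive_symmetric (O : set V) f x u v : open O -> O x ->
  (forall y, O y -> differentiable f y) ->
  differentiable ('D_u f) x -> differentiable ('D_v f) x ->
  'D_u ('D_v f) x = 'D_v ('D_u f) x.
Proof.
move=> oO Ox df du dv; apply/eqP; rewrite -subr_eq0 -normr_le0.
apply/ler_addgt0Pr => e e0; rewrite add0r.
have e20 : 0 < e / 2 by rewrite divr_gt0.
have [s [s0 [Hu Hv]]] := filter_ex (filterI (nbhs_right_gt (0 : R))
  (filterI (second_difference v oO Ox df du e20) (second_difference u oO Ox df dv e20))).
have s20 : 0 < s ^+ 2 by rewrite exprn_gt0.
move: Hu Hv; rewrite (addrAC x (s *: v) (s *: u)).
move: (f (x + s *: u + s *: v)) (f (x + s *: u)) (f (x + s *: v)) (f x).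
move: ('D_u ('D_v f) x) ('D_v ('D_u f) x) => a b p q r t Hu Hv.
rewrite -(ler_pM2l s20) -[X in X * _]gtr0_norm// -normrM.
rewrite [X in `|X|](_ : _ = (p - q - (r - t) - s ^+ 2 * b) -
  (p - r - (q - t) - s ^+ 2 * a)); last by ring.
rewrite (le_trans (ler_normB _ _))// (le_trans (lerD Hu Hv))//.
by rewrite -mulrDl -splitr mulrC.
Qed.
End Schwarz.

(** * Inner products and Frobenius norms *)

Section Dot.
Context {R : realType} {N : nat}.
Implicit Types u v w : 'rV[R]_N.

Lemma dotvE u v : dotv u v = (u *m v^T) 0 0.
Proof. by rewrite /dotv mxE; apply: eq_bigr => i _; rewrite mxE. Qed.

Lemma dotvC u v : dotv u v = dotv v u.
Proof. by apply: eq_bigr => i _; rewrite mulrC. Qed.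

Lemma dotvDl u v w : dotv (u + v) w = dotv u w + dotv v w.
Proof. by rewrite !dotvE mulmxDl mxE. Qed.

Lemma dotvNl u w : dotv (- u) w = - dotv u w.
Proof. by rewrite !dotvE mulNmx mxE. Qed.

Lemma dotvBl u v w : dotv (u - v) w = dotv u w - dotv v w.
Proof. by rewrite dotvDl dotvNl. Qed.

Lemma dotvZl a u w : dotv (a *: u) w = a * dotv u w.
Proof. by rewrite !dotvE -scalemxAl mxE. Qed.

Lemma dotv_mulmx u v (A : 'M[R]_N) : dotv (u *m A) v = dotv u (v *m A^T).
Proof. by rewrite !dotvE trmx_mul trmxK mulmxA. Qed.

Lemma dotv_ge0 u : 0 <= dotv u u.
Proof. by apply: sumr_ge0 => i _; rewrite -expr2 sqr_ge0. Qed.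

Lemma dotv_eq0 u : dotv u u = 0 -> u = 0.
Proof.
move=> /eqP; rewrite psumr_eq0 => [/allP u0|i _]; last by rewrite -expr2 sqr_ge0.
apply/rowP => i; rewrite mxE; apply/eqP.
by have := u0 i (mem_index_enum _); rewrite -expr2 sqrf_eq0.
Qed.

Lemma basis_vecE (i j : 'I_N) : (basis_vec i : 'rV[R]_N) 0 j = (j == i)%:R.
Proof. by rewrite /basis_vec mxE eqxx eq_sym. Qed.

Lemma dotv_basis u i : dotv u (basis_vec i) = u 0 i.
Proof.
rewrite /dotv (bigD1 i)//= basis_vecE eqxx mulr1 big1 ?addr0// => j ji.
by rewrite basis_vecE (negbTE ji) mulr0.
Qed.
End Dot.

Section Frobenius.
Context {R : realType}.

(** Lagrange's identity: the difference of both sides is half the sum of the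
    (a i * b j - a j * b i) ^+ 2. *)
Lemma cauchy_schwarz_sum (I : finType) (a b : I -> R) :
  (\sum_i a i * b i) ^+ 2 <= (\sum_i a i ^+ 2) * (\sum_i b i ^+ 2).
Proof.
rewrite -subr_ge0.
have : 0 <= \sum_i \sum_j (a i * b j - a j * b i) ^+ 2.
  by apply: sumr_ge0 => i _; apply: sumr_ge0 => j _; exact: sqr_ge0.
have -> : \sum_i \sum_j (a i * b j - a j * b i) ^+ 2 =
   ((\sum_i a i ^+ 2) * (\sum_i b i ^+ 2) - (\sum_i a i * b i) ^+ 2) *+ 2.
  have prodE (f g : I -> R) : (\sum_i f i) * (\sum_j g j) = \sum_i \sum_j f i * g j.
    by rewrite mulr_suml; apply: eq_bigr => i _; rewrite mulr_sumr.
  rewrite mulr2n [X in _ = _ - _ + (X - _)]mulrC [(\sum_i a i * b i) ^+ 2]expr2.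
  rewrite !prodE -!sumrB -big_split; apply: eq_bigr => i _ /=.
  rewrite -!sumrB -big_split; apply: eq_bigr => j _ /=; ring.
by rewrite pmulrn_lge0.
Qed.

Lemma sum_le_card_max (I : finType) (f : I -> R) : 0 < \sum_i f i ->
  exists i, \sum_i f i <= #|I|%:R * f i.
Proof.
move=> f0; apply: contrapT => /forallNP H.
have {}H i : #|I|%:R * f i < \sum_i f i by have /negP := H i; rewrite -ltNge.
have [I0|I0] := posnP #|I|.
  by move: f0; rewrite big1 ?ltxx// => i _; have := card0_eq I0 i.
have : \sum_(i : I) #|I|%:R * f i < \sum_(i : I) \sum_i f i.
  apply: ltr_sum => //; have /card_gt0P[i _] := I0; by apply/hasP; exists i; rewrite ?mem_index_enum.
by rewrite -mulr_sumr sumr_const -[X in _ < X]mulr_natl ltxx.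
Qed.

Definition frob2 {m n} (A : 'M[R]_(m, n)) : R := \sum_i \sum_j A i j ^+ 2.

Lemma frob2_ge0 {m n} (A : 'M[R]_(m, n)) : 0 <= frob2 A.
Proof. by apply: sumr_ge0 => i _; apply: sumr_ge0 => j _; exact: sqr_ge0. Qed.

Lemma frob2Z a m n (A : 'M[R]_(m, n)) : frob2 (a *: A) = a ^+ 2 * frob2 A.
Proof.
rewrite /frob2 mulr_sumr; apply: eq_bigr => i _; rewrite mulr_sumr.
by apply: eq_bigr => j _; rewrite mxE exprMn.
Qed.

Lemma frob2_mul {m n p} (A : 'M[R]_(m, n)) (B : 'M[R]_(n, p)) :
  frob2 (A *m B) <= frob2 A * frob2 B.
Proof.
rewrite /frob2 mulr_suml; apply: ler_sum => i _.
rewrite [X in _ <= _ * X]exchange_big /= mulr_sumr; apply: ler_sum => j _.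
by rewrite mxE; exact: cauchy_schwarz_sum.
Qed.

Lemma frob2_sym_mul {n} (S : 'M[R]_n) : S^T = S -> frob2 S = \tr (S *m S).
Proof.
move=> symS; rewrite /frob2 /mxtrace; apply: eq_bigr => i _; rewrite mxE.
by apply: eq_bigr => j _; rewrite -{3}symS mxE expr2.
Qed.

Lemma sym_expmx {n} (S : 'M[R]_n) j : S^T = S -> (S ^+ j)^T = S ^+ j.
Proof.
move=> symS; elim: j => [|j IH]; first by rewrite expr0 trmx1.
by rewrite {1}exprS trmx_mul IH symS exprSr.
Qed.

(** For symmetric S the square of the Frobenius norm of S^(j+1) is the scalar
    product of S^j and S^(j+2). *)
Lemma frob2_exp_logconvex {n} (S : 'M[R]_n) j : S^T = S ->
  frob2 (S ^+ j.+1) ^+ 2 <= frob2 (S ^+ j) * frob2 (S ^+ j.+2).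
Proof.
move=> symS.
have -> : frob2 (S ^+ j.+1) = \sum_(p : 'I_n * 'I_n) (S ^+ j) p.1 p.2 * (S ^+ j.+2) p.1 p.2.
  rewrite frob2_sym_mul ?sym_expmx// -[_ *m _]exprD addSnnS exprD.
  rewrite -(pair_bigA _ (fun i k => (S ^+ j) i k * (S ^+ j.+2) i k)) /=.
  rewrite /mxtrace; apply: eq_bigr => i _; rewrite mxE.
  by apply: eq_bigr => k _; rewrite -{1}(sym_expmx j.+2 symS) mxE.
apply: le_trans (cauchy_schwarz_sum _ _) _.
by rewrite /frob2 !pair_bigA.
Qed.

(** This bounds powers of S from below, which fails for nilpotent S: symmetry
    enters through the log-convexity of |S^j|^2, whose value at j = 0 is n. *)
Lemma frob2_exp_ge {n} (S : 'M[R]_n) j : S^T = S ->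
  frob2 S ^+ j.+1 <= n%:R ^+ j * frob2 (S ^+ j.+1).
Proof.
move=> symS.
have step k : frob2 S * frob2 (S ^+ k) <= n%:R * frob2 (S ^+ k.+1).
  elim: k => [|k IH].
    rewrite expr1 mulrC ler_wpM2r ?frob2_ge0// expr0 frob2_sym_mul ?trmx1//.
    by rewrite mulmx1 mxtrace1.
  have := frob2_exp_logconvex k symS.
  have := frob2_ge0 S; have := frob2_ge0 (S ^+ k); have := frob2_ge0 (S ^+ k.+2).
  have := frob2_ge0 (S ^+ k.+1); move: IH.
  set a := frob2 S; set b := frob2 (S ^+ k); set c := frob2 (S ^+ k.+1).
  set d := frob2 _ => abnc c0 d0 b0 a0 cbd.
  have [->|cN0] := eqVneq c 0; first by rewrite mulr0 mulr_ge0.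
  have cgt0 : 0 < c by rewrite lt_neqAle eq_sym cN0.
  have bgt0 : 0 < b.
    rewrite lt_neqAle b0 andbT eq_sym; apply: contraTneq cbd => ->.
    by rewrite mul0r -ltNge exprn_gt0.
  rewrite -(ler_pM2l bgt0).
  have -> : b * (a * c) = a * b * c by ring.
  apply: (le_trans (ler_wpM2r c0 abnc)).
  by rewrite -mulrA -expr2 [leRHS]mulrCA ler_wpM2l.
elim: j => [|j IH]; first by rewrite expr0 mul1r !expr1.
rewrite exprS (le_trans (ler_wpM2l (frob2_ge0 _) IH))// mulrCA [X in _ <= X * _]exprSr -mulrA.
by rewrite ler_wpM2l ?exprn_ge0.
Qed.

(** The diagonal entries of an orthogonal projection are at most 1 and its
    squared norm is its trace. *)
Lemma frob2_proj {n} (P : 'M[R]_n) : P^T = P -> P *m P = P -> frob2 P <= n%:R.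
Proof.
move=> symP PP.
rewrite frob2_sym_mul// PP /mxtrace -[leRHS]mulr1 -[n in leRHS]card_ord -sum1_card natr_sum mulr_suml.
apply: ler_sum => i _; rewrite mul1r.
have Pii : P i i ^+ 2 <= P i i.
  rewrite -{2}PP mxE (bigD1 i)//= -expr2 lerDl sumr_ge0// => j _.
  by rewrite -{2}symP mxE -expr2 sqr_ge0.
rewrite leNgt; apply: contraTN Pii => P1.
by rewrite -ltNge expr2 -[ltLHS]mulr1 ltr_pM2l// (lt_trans ltr01).
Qed.
End Frobenius.

(** * Smoothness of inverse maps *)

Section RowNorm.
Context {R : realType}.

Lemma entry_norm_le {N} (v : 'rV[R]_N) i : `|v 0 i| <= `|v|.
Proof.
rewrite [leRHS]/Num.Def.normr/= mx_normrE.
exact: (le_bigmax _ (fun ij : 'I_1 * 'I_N => `|v ij.1 ij.2|) (0, i)).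
Qed.

Lemma row_norm_le {N} (v : 'rV[R]_N) c : 0 <= c -> (forall i, `|v 0 i| <= c) -> `|v| <= c.
Proof.
move=> c0 vc; rewrite [leLHS]/Num.Def.normr/= mx_normrE.
by apply: bigmax_le => // -[i j] _ /=; rewrite ord1.
Qed.

Lemma mulmx_norm_le {N} (v : 'rV[R]_N) (A : 'M[R]_N) c : 0 <= c ->
  (forall i j, `|A i j| <= c) -> `|v *m A| <= N%:R * c * `|v|.
Proof.
move=> c0 Ac; apply: row_norm_le => [|j]; first by rewrite !mulr_ge0.
rewrite mxE (le_trans (ler_norm_sum _ _ _))//.
apply: (@le_trans _ _ (\sum_(i < N) c * `|v|)); last first.
  by rewrite sumr_const card_ord -[leLHS]mulr_natl mulrA.
by apply: ler_sum => i _; rewrite normrM mulrC ler_pM// entry_norm_le.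
Qed.

Lemma mulmx_norm_bound {N} (A : 'M[R]_N) :
  exists2 c, 0 < c & forall v : 'rV[R]_N, `|v *m A| <= c * `|v|.
Proof.
exists (N%:R * (\sum_i \sum_j `|A i j|) + 1).
  by rewrite ltr_wpDl// mulr_ge0// sumr_ge0// => i _; exact: sumr_ge0.
move=> v; apply: (@le_trans _ _ (N%:R * (\sum_i \sum_j `|A i j|) * `|v|)); last first.
  by rewrite ler_wpM2r// lerDl.
apply: mulmx_norm_le => [|i j].
  by apply: sumr_ge0 => i _; exact: sumr_ge0.
rewrite (bigD1 i)//= (bigD1 j)//= -addrA lerDl addr_ge0//; first exact: sumr_ge0.
by apply: sumr_ge0 => k _; exact: sumr_ge0.
Qed.

Lemma Ck_coord {N} k (U : set 'rV[R]_N) j : open U -> Ck k U (fun z : 'rV[R]_N => z 0 j).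
Proof.
move=> oU; case: k => //= k; split => [x _|v]; first exact: differentiable_coord.
apply: (@Ck_eq _ _ _ _ (cst (v 0 j))) => //; last exact: Ck_cst.
move=> x _; rewrite -(@derive_rV _ _ _ id x v j)//.
by rewrite derive_id.
Qed.

Lemma Ck_mulmx {V : normedModType R} {N} k (U : set V) (F : V -> 'rV[R]_N) (A : V -> 'M[R]_N) j :
  open U -> (forall i, Ck k U (entry F i)) -> (forall i j, Ck k U (fun z => A z i j)) ->
  Ck k U (entry (fun z => F z *m A z) j).
Proof.
move=> oU CF CA.
have CFA i : Ck k U (fun z => entry F i z * A z i j) by exact: Ck_mul.
apply: Ck_eq (Ck_sum (index_enum 'I_N) predT oU CFA) => // z _.
by rewrite /entry mxE.
Qed.

Lemma differentiable_mulmxr {N} (A : 'M[R]_N) x : differentiable (fun v : 'rV[R]_N => v *m A) x.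
Proof.
apply/differentiable_rV => j.
have /= [+ _] : Ck 1 [set: 'rV[R]_N] (entry (fun v => v *m A) j).
  apply: (@Ck_mulmx _ _ 1 _ id (cst A)) => [|i|i k]; first exact: openT.
    by apply: Ck_coord; exact: openT.
  by apply: Ck_cst; exact: openT.
by apply.
Qed.

(** Recognizes a derivative from an explicit estimate, when differentiability
    cannot be deduced from that of simpler functions. *)
Lemma differentiable_of_littleo {V W : normedModType R} (f : V -> W) (L : {linear V -> W}) x :
  continuous L ->
  (forall e, 0 < e -> \forall h \near (0 : V), `|f (x + h) - f x - L h| <= e * `|h|) ->
  differentiable f x /\ 'd f x = L :> (V -> W).
Proof.
move=> cL fL.
have fE : f \o shift x = cst (f x) + L +o_ 0 id.
  apply/eqaddoP => e e0; apply: filterS (fL e e0) => h.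
  by rewrite /= !fctE /= opprD addrA [h + x]addrC.
have dE : 'd f x = L :> (V -> W) by apply: diff_unique fE.
by split => //; apply/diff_locallyP; rewrite dE.
Qed.

End RowNorm.

Section InverseFunction.
Context {R : realType} {N : nat}.
Implicit Types (x y z v w : 'rV[R]_N) (E Z : 'rV[R]_N -> 'rV[R]_N).

Lemma jac_near (W : set 'rV[R]_N) E z0 e : smooth_on W E -> W z0 -> open W -> 0 < e ->
  \forall z \near z0, forall a c, `|jac E z a c - jac E z0 a c| <= e.
Proof.
move=> sE Wz0 oW e0.
suff : \forall z \near z0, forall ac : 'I_N * 'I_N, `|jac E z ac.1 ac.2 - jac E z0 ac.1 ac.2| <= e.
  by apply: filterS => z H a c; exact: (H (a, c)).
apply: (@filter_forall _ _ (fun (ac : 'I_N * 'I_N) z => `|jac E z ac.1 ac.2 - jac E z0 ac.1 ac.2| <= e) (nbhs z0) _) => -[a c] /=.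
have sEc := smooth_entry c oW sE.
have /differentiable_continuous := smooth_on_diff (smooth_on_derive (basis_vec a) sEc) Wz0.
move/cvgrPdist_le => /(_ _ e0); apply: filterS => z; rewrite distrC.
by rewrite /jac !mxE.
Qed.

(** Mean values along segments of the ball: a bound on the oscillation of the
    Jacobian controls increments between two arbitrary points. *)
Lemma strict_estimate (z0 : 'rV[R]_N) (r e : R) E :
  (forall z, ball z0 r z -> differentiable E z) ->
  0 <= e -> (forall z, ball z0 r z -> forall a c, `|jac E z a c - jac E z0 a c| <= e) ->
  forall z z', ball z0 r z -> ball z0 r z' ->
  `|E z - E z' - (z - z') *m jac E z0| <= N%:R * e * `|z - z'|.
Proof.
move=> dE e0 HE z z' bz bz'.
apply: row_norm_le => [|c]; first by rewrite !mulr_ge0.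
have bseg t : 0 <= t <= 1 -> ball z0 r (z' + t *: (z - z')).
  move=> /andP[t0 t1]; move: bz bz'; rewrite -!ball_normE /= => bz bz'.
  have -> : z0 - (z' + t *: (z - z')) = t *: (z0 - z) + (1 - t) *: (z0 - z').
    by rewrite !scalerBr !scalerBl !scale1r; apply/rowP => i; rewrite !mxE; ring.
  rewrite (le_lt_trans (ler_normD _ _))// !normrZ !ger0_norm ?subr_ge0//.
  have [->|tN0] := eqVneq t 0; first by rewrite mul0r add0r subr0 mul1r.
  have tgt0 : 0 < t by rewrite lt_neqAle eq_sym tN0.
  have -> : r = t * r + (1 - t) * r by ring.
  by rewrite ltr_leD// ?ltr_pM2l// ler_wpM2l ?subr_ge0// ltW.
have [|t /andP[t0 t1] Et] := @mvt_line _ _ (entry E c) z' (z - z').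
  by move=> t t01; have /differentiable_rV := dE _ (bseg _ t01); apply.
have t01 : 0 <= t <= 1 by rewrite !ltW.
have dt := dE _ (bseg _ t01).
have -> : (E z - E z' - (z - z') *m jac E z0) 0 c =
   ((z - z') *m (jac E (z' + t *: (z - z')) - jac E z0)) 0 c.
  rewrite mulmxBr -(derive_jac _ dt).
  have sub_entry (u v w : 'rV[R]_N) : u 0 c = v 0 c -> (u - w) 0 c = (v - w) 0 c.
    by rewrite !mxE => ->.
  apply: sub_entry.
  by rewrite derive_rV// -/(entry E c) -Et [z' + _]addrC subrK [LHS]mxE [X in _ + X]mxE.
apply: le_trans (entry_norm_le _ _) _.
by apply: mulmx_norm_le => // a b; rewrite !mxE; have := HE _ (bseg _ t01) a b; rewrite !mxE.
Qed.

Lemma unitmx_inj (A : 'M[R]_N) : (forall v, v *m A = 0 -> v = 0) -> A \in unitmx.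
Proof.
move=> inj; rewrite unitmxE unitfE; apply/negP => /det0P[v v0 vA].
by move: v0; rewrite (inj _ vA) eqxx.
Qed.

(** The strict estimate with an oscillation small against the inverse Jacobian:
    the linear part then dominates increments of E, so E is injective with
    Lipschitz inverse, and nearby Jacobians have trivial kernel as well. *)
Lemma local_injectivity (W : set 'rV[R]_N) E z0 : open W -> W z0 -> smooth_on W E ->
  jac E z0 \in unitmx -> exists r K : R, [/\ 0 < r, 0 < K, ball z0 r `<=` W,
    (forall z z', ball z0 r z -> ball z0 r z' -> `|z - z'| <= K * `|E z - E z'|) &
    (forall z, ball z0 r z -> jac E z \in unitmx)].
Proof.
move=> oW Wz0 sE uJ.
have [k k0 Hk] := mulmx_norm_bound (invmx (jac E z0)).
have kJ w : `|w| <= k * `|w *m jac E z0| by rewrite -{1}[w](mulmxK uJ) Hk.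
(* The error N e |z - z'| is at most half of |z - z'| / k; the summand 1 allows
   N = 0. *)
pose e := (2 * (k * (N%:R + 1)))^-1.
have N1 : 0 < (N%:R + 1 : R) by rewrite ltr_wpDl.
have e0 : 0 < e by rewrite invr_gt0 !mulr_gt0.
have ke : k * (N%:R * e) <= 1 / 2.
  have -> : 1 / 2 = k * ((N%:R + 1) * e) by rewrite /e; field; rewrite !gt_eqF.
  by rewrite ler_pM2l// ler_wpM2r ?(ltW e0)// lerDl.
have nW : \forall z \near z0, W z by exact: open_nbhs_nbhs.
have [r /= r0 Hr] := (nbhs_ballP _ _).1 (filterI nW (jac_near sE Wz0 oW e0)).
have bW : ball z0 r `<=` W by move=> z /Hr[].
have dE z : ball z0 r z -> differentiable E z by move=> /bW; exact: smooth_on_diff.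
have HJ z : ball z0 r z -> forall a c, `|jac E z a c - jac E z0 a c| <= e by move=> /Hr[].
exists r, (2 * k); split => //; first by rewrite mulr_gt0.
  move=> z z' bz bz'.
  have H1 := strict_estimate dE (ltW e0) HJ bz bz'.
  have H2 : k * `|(z - z') *m jac E z0| <= k * `|E z - E z'| + 1 / 2 * `|z - z'|.
    apply: (@le_trans _ _ (k * (`|E z - E z'| + N%:R * e * `|z - z'|))).
      rewrite ler_pM2l// -[X in `|X| <= _](subKr (E z - E z')).
      by rewrite (le_trans (ler_normB _ _))// lerD2l.
    by rewrite mulrDr lerD2l mulrA ler_wpM2r// (le_trans _ ke)// mulrA.
  have := le_trans (kJ _) H2; lra.
move=> z bz; apply: unitmx_inj => v vJ.
have H3 : `|v *m jac E z0| <= N%:R * e * `|v|.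
  have -> : v *m jac E z0 = - (v *m (jac E z - jac E z0)) by rewrite mulmxBr vJ sub0r opprK.
  rewrite normrN; apply: mulmx_norm_le => [|a b]; first exact: ltW.
  by rewrite !mxE; have := HJ _ bz a b; rewrite !mxE.
apply/eqP; rewrite -normr_le0.
have H4 : `|v| <= k * (N%:R * e) * `|v| by rewrite (le_trans (kJ _))// -mulrA ler_pM2l.
have := le_trans H4 (ler_wpM2r (normr_ge0 v) ke); lra.
Qed.

(** The Lipschitz bound turns o(Z x' - Z x) into o(x' - x), so that Z is
    differentiable with derivative the inverse of the Jacobian of E at Z x.
    This expresses the derivative of Z as a smooth function of Z, and the order
    of smoothness of Z increases by induction. *)
Lemma smooth_inverse (W O : set 'rV[R]_N) E Z (K : R) : open W -> open O -> smooth_on W E ->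
  (forall z, W z -> jac E z \in unitmx) -> (forall x, O x -> W (Z x)) ->
  (forall x, O x -> E (Z x) = x) ->
  (forall x x', O x -> O x' -> `|Z x - Z x'| <= K * `|x - x'|) ->
  0 < K -> smooth_on O Z.
Proof.
move=> oW oO sE uJ ZW EZ ZK.
move=> K0.
have dZ x : O x -> differentiable Z x /\ forall v, 'D_v Z x = v *m invmx (jac E (Z x)).
  move=> Ox; set A := jac E (Z x).
  have uA : A \in unitmx by exact/uJ/ZW.
  have dE : differentiable E (Z x) by exact: smooth_on_diff sE (ZW _ Ox).
  have [c c0 Hc] := mulmx_norm_bound (invmx A).
  have cL : continuous (mulmxr (invmx A) : {linear 'rV[R]_N -> 'rV[R]_N}).
    by move=> y; apply: differentiable_continuous; exact: differentiable_mulmxr.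
  have [|dZx DZ] := differentiable_of_littleo (f := Z) (x := x) cL; last first.
    by split=> // v; rewrite deriveE// DZ.
  move=> e e0.
  have e1 : 0 < e / (c * K) by rewrite divr_gt0 ?mulr_gt0.
  have := diff_locally dE => /eqaddoP /(_ _ e1) /nbhs_ballP[d /= d0 Hd].
  have nO : \forall h \near (0 : 'rV[R]_N), O (x + h).
    have : \forall z \near x, O z by exact: open_nbhs_nbhs.
    by rewrite (near_shift 0 x); apply: filterS => h /=; rewrite subr0 addrC.
  have nd : \forall h \near (0 : 'rV[R]_N), `|h| < d / K by apply: nbhs0_lt; rewrite divr_gt0.
  apply: filterS2 nO nd => h Oh hd /=.
  set k := Z (x + h) - Z x.
  have kK : `|k| <= K * `|h|.
    by have := ZK _ _ Oh Ox; rewrite [x + h - x]addrC addKr.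
  have /Hd : ball (0 : 'rV[R]_N) d k.
    by rewrite -ball_normE /= sub0r normrN (le_lt_trans kK)// mulrC -ltr_pdivlMr.
  rewrite /= !fctE /= subrK !EZ// -deriveE// derive_jac// -/A opprD addrA [x + h]addrC addrK => Hk.
  have -> : k - h *m invmx A = - ((h - k *m A) *m invmx A).
    by rewrite mulmxBl mulmxK// opprB.
  rewrite normrN (le_trans (Hc _))// (le_trans (ler_wpM2l (ltW c0) Hk))//.
  rewrite (le_trans (ler_wpM2l (ltW c0) (ler_wpM2l (ltW e1) kK)))//.
  by rewrite [leLHS](_ : _ = e * `|h|)//; field; rewrite !gt_eqF.
have CE i : forall k, Ck k W (entry E i).
  by move=> k; exact/smooth_on_Ck/smooth_entry.
have CG k i j : Ck k W (fun z => invmx (jac E z) i j).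
  apply: Ck_invmx => // a b.
  apply: (@Ck_eq _ _ _ _ ('D_(basis_vec a) (entry E b))) => //.
    by move=> z _; rewrite mxE.
  by have /= [_] := CE b k.+1; apply.
have CZ k : forall i, Ck k O (entry Z i).
  elim: k => // k IH i; split => [x Ox|v].
    by have [/differentiable_rV + _] := dZ x Ox; apply.
  apply: (@Ck_eq _ _ _ _ (entry (fun x => v *m invmx (jac E (Z x))) i)) => //.
    move=> x /[!inE] Ox; have [dZx DZ] := dZ x Ox.
    by rewrite /entry -DZ derive_rV.
  apply: Ck_mulmx => // [j|a b]; first exact: Ck_cst.
  by apply: (@Ck_comp _ _ _ k _ W (fun z => invmx (jac E z) a b)).
apply/smooth_on_rV => // i; apply/smooth_onP => k; exact: CZ.
Qed.
End InverseFunction.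

(** * Nearest points *)

Section DotCalculus.
Context {R : realType}.

Lemma differentiable_dotv {V : normedModType R} {N} (F G : V -> 'rV[R]_N) x :
  differentiable F x -> differentiable G x ->
  differentiable (fun y => dotv (F y) (G y)) x.
Proof.
move=> /differentiable_rV dF /differentiable_rV dG.
rewrite (_ : (fun y => _) = \sum_(i < N) (entry F i * entry G i)).
  by apply: differentiable_sum => i; exact: (differentiableM (dF i) (dG i)).
by apply/funext => y; rewrite fct_sumE.
Qed.

Lemma derive_dotv {V : normedModType R} {N} (F G : V -> 'rV[R]_N) x v :
  differentiable F x -> differentiable G x ->
  'D_v (fun y => dotv (F y) (G y)) x = dotv ('D_v F x) (G x) + dotv (F x) ('D_v G x).
Proof.
move=> dF dG; have /differentiable_rV dFi := dF; have /differentiable_rV dGi := dG.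
rewrite (_ : (fun y => _) = \sum_(i < N) (entry F i * entry G i)); last first.
  by apply/funext => y; rewrite fct_sumE.
rewrite derive_sum; last by move=> i; apply: diff_derivable; exact: (differentiableM (dFi i) (dGi i)).
rewrite /dotv -big_split; apply: eq_bigr => i _ /=.
rewrite deriveM; [|exact: diff_derivable (dFi i)|exact: diff_derivable (dGi i)].
by rewrite (derive_rV v i dF) (derive_rV v i dG) [RHS]addrC [X in _ = _ + X]mulrC.
Qed.

Lemma fermat_line {V : normedModType R} (O : set V) (f : V -> R) x a : open O -> O x ->
  (forall y, O y -> differentiable f y) ->
  (\forall t \near (0 : R), f x <= f (x + t *: a)) -> 'D_a f x = 0.
Proof.
move=> oO Ox df fmin.
have nO := near_line a oO Ox.
have [d /= d0 Hd] := (nbhs_ballP _ _).1 (filterI nO fmin).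
have Hd' t : t \in `]- d, d[%R -> O (x + t *: a) /\ f x <= f (x + t *: a).
  move=> td; apply: Hd; rewrite /ball/= sub0r normrN ltr_norml.
  by move: td; rewrite in_itv.
have [] := @derive1_at_min R (fun t => f (x + t *: a)) (- d) d 0.
- by rewrite ge0_cp// ltW.
- by move=> t /Hd'[Ot _]; have [] := is_derive_line (df _ Ot).
- by rewrite in_itv/= oppr_lt0 d0.
- by move=> t /Hd'[_]; rewrite scale0r addr0.
have [|_ ->] := @is_derive_line _ _ _ f x a 0; first by rewrite scale0r addr0; exact: df.
by rewrite scale0r addr0.
Qed.
End DotCalculus.

Section Nearest.
Context {R : realType} {N : nat}.
Implicit Types (M : set 'rV[R]_N) (x y z : 'rV[R]_N).

Definition nearest M x y := M y /\ forall z, M z -> dotv (x - y) (x - y) <= dotv (x - z) (x - z).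

Lemma nearest_exists M x : compact M -> M !=set0 -> exists y, nearest M x y.
Proof.
move=> cM M0.
have cf : continuous (fun z => dotv (x - z) (x - z)).
  move=> z; apply: differentiable_continuous.
  by apply: differentiable_dotv; apply: differentiableB.
have [|y yM Hy] := EVT_min_rV (f := fun z => dotv (x - z) (x - z)) M0 cM.
  exact: continuous_subspaceT.
by exists y; split; [rewrite inE in yM|move=> z Mz; apply: Hy; rewrite inE].
Qed.

Lemma dotv_sub_sqr x y : dotv (x - y) (x - y) = dotv x x - 2 * dotv x y + dotv y y.
Proof.
rewrite dotvBl [dotv x (x - y)]dotvC [dotv y (x - y)]dotvC !dotvBl [dotv y x]dotvC; ring.
Qed.

Lemma enorm_sqr x : enorm x ^+ 2 = dotv x x.
Proof. by rewrite sqr_sqrtr// dotv_ge0. Qed.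

Lemma dist_to_nearest M x y : nearest M x y -> dist_to M x = enorm (x - y).
Proof.
move=> [My Hy]; apply/le_anti/andP; split.
  apply: ge_inf; last by exists y.
  by exists 0 => _ [z _ <-]; exact: sqrtr_ge0.
apply: lb_le_inf; first by exists (enorm (x - y)), y.
by move=> _ [z Mz <-]; rewrite ler_wsqrtr// Hy.
Qed.

Lemma AM_nearest M x y : nearest M x y -> AM M x = dotv x y - dotv y y / 2.
Proof.
move=> nxy; by rewrite /AM (dist_to_nearest nxy) !enorm_sqr dotv_sub_sqr; field.
Qed.

(** A^M is a supremum of affine functions, attained at the nearest point; this
    identifies its gradient. *)
Lemma AM_ge M x y : compact M -> M y -> dotv x y - dotv y y / 2 <= AM M x.
Proof.
move=> cM My; have [|z nxz] := nearest_exists x cM; first by exists y.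
rewrite (AM_nearest nxz); have [_ /(_ _ My)] := nxz.
rewrite !dotv_sub_sqr; lra.
Qed.

Lemma norm_le_dotv x : `|x| ^+ 2 <= dotv x x.
Proof.
rewrite -enorm_sqr lerXn2r// ?nnegrE ?sqrtr_ge0//.
apply: row_norm_le => [|i]; first exact: sqrtr_ge0.
rewrite -sqrtr_sqr ler_wsqrtr// /dotv (bigD1 i)//= -expr2 lerDl.
by apply: sumr_ge0 => j _; rewrite -expr2 sqr_ge0.
Qed.

Lemma dotv_le_norm x : dotv x x <= N%:R * `|x| ^+ 2.
Proof.
have -> : N%:R * `|x| ^+ 2 = \sum_(i < N) `|x| ^+ 2 by rewrite sumr_const card_ord mulr_natl.
apply: ler_sum => i _.
by rewrite -expr2 -real_normK ?num_real// lerXn2r ?nnegrE// entry_norm_le.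
Qed.

(** The factor N compares the sup norm of the topology with the Euclidean
    norm. *)
Lemma nearest_norm M x x0 y : M x0 -> nearest M x y -> `|x - y| <= N%:R * `|x - x0|.
Proof.
move=> Mx0 [_ /(_ _ Mx0) H].
rewrite -(@ler_pXn2r _ 2)// ?nnegrE ?mulr_ge0//.
apply: le_trans (norm_le_dotv _) _; apply: le_trans H _; apply: le_trans (dotv_le_norm _) _.
rewrite exprMn ler_wpM2r ?sqr_ge0// -natrX ler_nat.
by case: (N) => // k; rewrite expnS leq_pmulr.
Qed.
End Nearest.

(** * The nearest point projection near a point of M *)

(** All that the estimate needs from the nearest point map p on a
    neighbourhood O of x0.  In [lp_fiber] the premise on z says that z is
    orthogonal to the fixed vectors of Dp(y), that is to the tangent space at
    y; the conclusion says that the normal fibre through y projects to y. *)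
Record local_projection (R : realType) (N : nat) (M : set 'rV[R]_N) (x0 : 'rV[R]_N)
    (O : set 'rV[R]_N) (p : 'rV[R]_N -> 'rV[R]_N) : Prop := LocalProjection {
  lp_open : open O;
  lp_in : O x0;
  lp_base : M x0;
  lp_smooth : smooth_on O p;
  lp_range : forall x, M (p x);
  lp_fix : forall y, M y -> p y = y;
  lp_grad : forall x v, O x -> differentiable (AM M) x /\ 'D_v (AM M) x = dotv v (p x);
  lp_fiber : exists2 e : R, 0 < e & forall y z, M y -> `|y - x0| < e -> `|z| < e ->
    (forall u, 'D_u p y = u -> dotv z u = 0) -> p (y + z) = y;
  lp_nontrivial : exists2 w, w != 0 & 'D_w p x0 = w }.

Section MulmxDerive.
Context {R : realType} {V : normedModType R} {N : nat}.

Lemma mulmx_entryE (F : V -> 'rV[R]_N) (A : V -> 'M[R]_N) j :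
  entry (fun z => F z *m A z) j = fun z => dotv (F z) (\row_c A z c j).
Proof.
apply/funext => z; rewrite /entry mxE; apply: eq_bigr => c _; by rewrite [X in _ = _ * X]mxE.
Qed.

Lemma differentiable_col (A : V -> 'M[R]_N) z j :
  (forall c j, differentiable (fun z => A z c j) z) -> differentiable (fun z => \row_c A z c j) z.
Proof.
move=> dA; apply/differentiable_rV => c.
by rewrite (_ : (fun y => _) = fun y => A y c j)//; apply/funext => y; rewrite mxE.
Qed.

Lemma differentiable_mulmx (F : V -> 'rV[R]_N) (A : V -> 'M[R]_N) z :
  differentiable F z -> (forall c j, differentiable (fun z => A z c j) z) ->
  differentiable (fun z => F z *m A z) z.
Proof.
move=> dF dA; apply/differentiable_rV => j; rewrite -/(entry _ j) mulmx_entryE.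
by apply: differentiable_dotv => //; exact: differentiable_col.
Qed.

(** Where F vanishes, the derivative of A does not contribute. *)
Lemma derive_mulmx0 (F : V -> 'rV[R]_N) (A : V -> 'M[R]_N) z a :
  differentiable F z -> (forall c j, differentiable (fun z => A z c j) z) -> F z = 0 ->
  'D_a (fun z => F z *m A z) z = 'D_a F z *m A z.
Proof.
move=> dF dA F0; apply/rowP => j; rewrite derive_rV; last exact: differentiable_mulmx.
rewrite -/(entry _ j) mulmx_entryE derive_dotv//; last exact: differentiable_col.
rewrite F0 [X in _ + X]dotvE mul0mx [X in _ + X]mxE addr0 mxE.
by apply: eq_bigr => c _; rewrite [X in _ * X]mxE.
Qed.
End MulmxDerive.

Section Chart.
Context {R : realType} {n m : nat}.
Local Notation N := (n + m)%N.
Context (M U V : set 'rV[R]_N) (Phi Psi : 'rV[R]_N -> 'rV[R]_N) (x0 : 'rV[R]_N).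
Hypotheses (Mx0 : M x0) (oU : open U) (oV : open V) (Ux0 : U x0)
  (sPhi : smooth_on U Phi) (sPsi : smooth_on V Psi)
  (PhiK : forall y, U y -> V (Phi y) /\ Psi (Phi y) = y)
  (PsiK : forall z, V z -> U (Psi z) /\ Phi (Psi z) = z)
  (flat : forall y, U y -> (M y <-> rsubmx (Phi y) = 0)).
Implicit Types (x y z v w a : 'rV[R]_N).

(** Projections of R^(n+m) on R^n x {0} and {0} x R^m; the chart maps M to the
    image of the first. *)
Definition flat_mx : 'M[R]_N := block_mx 1%:M 0 0 0.
Definition flat_compl_mx : 'M[R]_N := block_mx 0 0 0 1%:M.

Lemma flat_mx_compl : flat_mx + flat_compl_mx = 1%:M.
Proof. by rewrite /flat_mx /flat_compl_mx add_block_mx !addr0 !add0r -scalar_mx_block. Qed.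

Lemma flat_mx_sym : flat_mx^T = flat_mx.
Proof. by rewrite /flat_mx tr_block_mx !trmx0 trmx1. Qed.

Lemma flat_mx_idem : flat_mx *m flat_mx = flat_mx.
Proof. by rewrite /flat_mx mulmx_block !mulmx0 !mul0mx mulmx1 !addr0. Qed.

Lemma mul_flat_compl z : z *m flat_compl_mx = z - z *m flat_mx.
Proof. by rewrite -[flat_compl_mx](addKr flat_mx) flat_mx_compl mulmxDr mulmxN mulmx1 addrC. Qed.

Lemma flatE z : rsubmx z = 0 <-> z *m flat_mx = z.
Proof.
rewrite -{2 3}[z]hsubmxK /flat_mx mul_row_block !mulmx0 mulmx1 !addr0; split => [->//|].
by move=> /(congr1 rsubmx); rewrite !row_mxKr.
Qed.

Lemma Phi_flat y : M y -> U y -> Phi y *m flat_mx = Phi y.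
Proof. by move=> My Uy; apply/flatE/flat. Qed.

Lemma dPhi y : U y -> differentiable Phi y. Proof. exact: smooth_on_diff sPhi. Qed.
Lemma dPsi z : V z -> differentiable Psi z. Proof. exact: smooth_on_diff sPsi. Qed.

Lemma jac_PhiPsi y : U y -> jac Phi y *m jac Psi (Phi y) = 1%:M.
Proof.
move=> Uy; have [VPhi _] := PhiK Uy.
apply/row_matrixP => i; rewrite row_mul rowE row1.
rewrite -(derive_jac _ (dPhi Uy)) -(derive_jac _ (dPsi VPhi)).
rewrite -(derive_chain (delta_mx 0 i) (dPhi Uy) (dPsi VPhi)) -[RHS](derive_id y (delta_mx 0 i)).
apply: (derive_eq_on _ oU); last by rewrite inE.
by move=> z /[!inE] Uz; have [] := PhiK Uz.
Qed.

Lemma jac_PsiPhi y : U y -> jac Psi (Phi y) *m jac Phi y = 1%:M.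
Proof. by move=> Uy; apply: mulmx1C; exact: jac_PhiPsi. Qed.

Lemma chart_curve y a : M y -> U y -> a *m flat_mx = a ->
  \forall t \near (0 : R), V (Phi y + t *: a) /\ M (Psi (Phi y + t *: a)).
Proof.
move=> My Uy aI.
have [VPhi _] := PhiK Uy.
have nV := near_line a oV VPhi.
apply: filterS nV => t Vt; split => //.
have [Ut Et] := PsiK Vt.
by apply/(flat Ut); rewrite Et; apply/flatE; rewrite mulmxDl Phi_flat// -scalemxAl aI.
Qed.

(** Orthogonality to the tangent space at y, which the chart spans by
    directional derivatives of Psi. *)
Definition normal_at y z := forall a, a *m flat_mx = a -> dotv z (a *m jac Psi (Phi y)) = 0.

Lemma normal_atE y z : normal_at y z -> z *m (jac Psi (Phi y))^T *m flat_mx = 0.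
Proof.
move=> nz; apply: dotv_eq0.
by rewrite dotv_mulmx flat_mx_sym dotv_mulmx trmxK nz// -mulmxA flat_mx_idem.
Qed.

(** The squared distance from x, read in the chart, is stationary along M at
    its minimum. *)
Lemma nearest_normal x y : U y -> nearest M x y -> normal_at y (x - y).
Proof.
move=> Uy [My Hy] a aI.
have [VPhi PsiPhi] := PhiK Uy.
pose f z := dotv (x - Psi z) (x - Psi z).
have dx z : V z -> differentiable (fun z => x - Psi z) z.
  by move=> Vz; apply: differentiableB => //; exact: dPsi.
have Dx : 'D_a (fun z => x - Psi z) (Phi y) = - (a *m jac Psi (Phi y)).
  rewrite deriveB//; last by apply: diff_derivable; exact: dPsi.
  by rewrite derive_cst sub0r derive_jac//; exact: dPsi.
have : 'D_a f (Phi y) = 0.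
  apply: (fermat_line oV VPhi) => [z Vz|].
    by apply: differentiable_dotv; exact: dx.
  apply: filterS (chart_curve My Uy aI) => t [_ Mt].
  by rewrite /f PsiPhi; exact: Hy.
rewrite /f derive_dotv; [|exact: dx|exact: dx].
rewrite Dx PsiPhi [dotv (x - y) (- _)]dotvC dotvNl dotvC; lra.
Qed.

(** The tubular parametrization: (u, w) is sent to the point of M with chart
    coordinate u plus the combination with coefficients w of the gradients of
    the last m components of Phi, which span the normal space there. *)
Definition tube z := Psi (z *m flat_mx) + z *m flat_compl_mx *m (jac Phi (Psi (z *m flat_mx)))^T.
Definition tubedom := [set z : 'rV[R]_N | V (z *m flat_mx)].
(** Tubular coordinates of y + z for z normal at y in M: the gradients of Phi
    are dual to the derivatives of Psi. *)
Definition tubeinv y z := Phi y + z *m (jac Psi (Phi y))^T.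

Lemma tubeinv_flat y z : M y -> U y -> normal_at y z -> tubeinv y z *m flat_mx = Phi y.
Proof. by move=> My Uy nz; rewrite mulmxDl Phi_flat// normal_atE// addr0. Qed.

Lemma tubeK y z : M y -> U y -> normal_at y z -> tube (tubeinv y z) = y + z.
Proof.
move=> My Uy nz; rewrite /tube mul_flat_compl tubeinv_flat//.
have [_ ->] := PhiK Uy.
by rewrite /tubeinv [Phi y + _]addrC addrK -mulmxA -trmx_mul jac_PhiPsi// trmx1 mulmx1.
Qed.

Lemma open_tubedom : open tubedom.
Proof.
apply: (@open_comp _ _ (fun z : 'rV[R]_N => z *m flat_mx) V) => // z _.
by apply: differentiable_continuous; exact: differentiable_mulmxr.
Qed.

Lemma Ck_mulmxr k (O : set 'rV[R]_N) (A : 'M[R]_N) i : open O ->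
  Ck k O (entry (fun z => z *m A) i).
Proof. by move=> oO; apply: Ck_mulmx => // *; [exact: Ck_coord|exact: Ck_cst]. Qed.

Lemma Ck_tube_base k i : Ck k tubedom (entry (fun z => Psi (z *m flat_mx)) i).
Proof.
apply: (@Ck_comp _ _ _ k _ V (entry Psi i)) => //; first exact: open_tubedom.
  exact/smooth_on_Ck/smooth_entry.
by move=> j; apply: Ck_mulmxr; exact: open_tubedom.
Qed.

Lemma Ck_tube_fiber k (c d : 'I_N) : Ck k tubedom (fun z => (jac Phi (Psi (z *m flat_mx)))^T c d).
Proof.
have oT := open_tubedom.
apply: (@Ck_eq _ _ _ _ (fun z => 'D_(basis_vec d) (entry Phi c) (Psi (z *m flat_mx)))) => //.
  by move=> z _; rewrite !mxE.
apply: (@Ck_comp _ _ _ k _ U ('D_(basis_vec d) (entry Phi c))) => //.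
- by move=> z Vz; have [] := PsiK Vz.
- exact/smooth_on_Ck/smooth_on_derive/smooth_entry.
- exact: Ck_tube_base.
Qed.

Lemma tube_smooth : smooth_on tubedom tube.
Proof.
have oT := open_tubedom.
apply/smooth_on_rV => // i; apply/smooth_onP => k.
apply: (@Ck_eq _ _ _ _ (fun z => entry (fun z => Psi (z *m flat_mx)) i z +
   entry (fun z => (z *m flat_compl_mx) *m (jac Phi (Psi (z *m flat_mx)))^T) i z)) => //.
  by move=> z _; rewrite /entry /tube [in RHS]mxE.
apply: Ck_add => //; first exact: Ck_tube_base.
apply: Ck_mulmx => // [j|a b]; [exact: Ck_mulmxr|exact: Ck_tube_fiber].
Qed.

Let z0 := Phi x0.

Lemma z0_flat : z0 *m flat_mx = z0. Proof. exact: Phi_flat. Qed.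

Lemma z0dom : tubedom z0.
Proof. by rewrite /tubedom /= z0_flat; have [] := PhiK Ux0. Qed.

(** The dependence of the normal frame on the base point is invisible to first
    order where the normal coordinate vanishes. *)
Lemma jac_tube : jac tube z0 = flat_mx *m jac Psi z0 + flat_compl_mx *m (jac Phi x0)^T.
Proof.
have [Vz0 Psiz0] := PhiK Ux0.
have dI (A : 'M[R]_N) z : differentiable (fun z : 'rV[R]_N => z *m A) z by exact: differentiable_mulmxr.
have DI (A : 'M[R]_N) v z : 'D_v (fun z : 'rV[R]_N => z *m A) z = v *m A.
  have cA : continuous (mulmxr A : {linear 'rV[R]_N -> 'rV[R]_N}).
    by move=> w; apply: differentiable_continuous; exact: dI.
  by rewrite deriveE//; have := congr1 (fun f => f v) (diff_lin z cA).
have z0I2 : z0 *m flat_compl_mx = 0 by rewrite mul_flat_compl z0_flat subrr.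
apply/row_matrixP => i; rewrite !rowE -derive_jac; last exact: smooth_on_diff tube_smooth z0dom.
set a := delta_mx 0 i; rewrite mulmxDr !mulmxA.
have dP : differentiable (fun z => Psi (z *m flat_mx)) z0.
  apply: (@differentiable_comp _ _ _ _ (fun z : 'rV[R]_N => z *m flat_mx) Psi) => //.
  by rewrite z0_flat; exact: dPsi.
have dJ c j : differentiable (fun z => (jac Phi (Psi (z *m flat_mx)))^T c j) z0.
  have /= [+ _] := Ck_tube_fiber 1 c j; apply; exact: z0dom.
rewrite /tube deriveD; [|exact: diff_derivable|].
  have dPz : differentiable Psi (z0 *m flat_mx) by rewrite z0_flat; exact: dPsi.
  rewrite (derive_mulmx0 _ (dI flat_compl_mx z0) dJ z0I2) (derive_chain a (dI flat_mx z0) dPz).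
  by rewrite !DI z0_flat Psiz0 derive_jac//; exact: dPsi.
by apply: diff_derivable; exact: differentiable_mulmx.
Qed.

(** Tangent and normal parts of a vector in the kernel are orthogonal to each
    other and opposite, hence both vanish. *)
Lemma jac_tube_unit : jac tube z0 \in unitmx.
Proof.
have JP := jac_PhiPsi Ux0; have PJ := jac_PsiPhi Ux0.
apply: unitmx_inj => al; rewrite jac_tube mulmxDr !mulmxA.
set JPsi := jac Psi z0 in JP PJ *; set JPhi := jac Phi x0 in JP PJ *.
move=> /eqP; rewrite addr_eq0 => /eqP E.
have v0 : al *m flat_mx *m JPsi = 0.
  apply: dotv_eq0; rewrite {2}E dotvC dotvNl dotv_mulmx trmxK -mulmxA PJ mulmx1.
  by rewrite dotvC dotv_mulmx flat_mx_sym mul_flat_compl mulmxBl -mulmxA flat_mx_idem subrr dotvE trmx0 mulmx0 mxE oppr0.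
have al1 : al *m flat_mx = 0 by rewrite -[LHS]mulmx1 -PJ mulmxA v0 mul0mx.
have al2 : al *m flat_compl_mx = 0.
  have : al *m flat_compl_mx *m JPhi^T *m JPsi^T = 0.
    by apply/eqP; rewrite -[_ *m JPhi^T]opprK -E v0 oppr0 mul0mx.
  by rewrite -mulmxA -trmx_mul PJ trmx1 mulmx1.
by rewrite -[al]mulmx1 -flat_mx_compl mulmxDr al1 al2 addr0.
Qed.

Lemma tubeinv_near r : 0 < r -> exists2 e : R, 0 < e &
  forall y z, `|y - x0| < e -> `|z| < e -> U y /\ ball z0 r (tubeinv y z).
Proof.
move=> r0.
have [Vz0 _] := PhiK Ux0.
have r20 : 0 < r / 2 by rewrite divr_gt0.
have [c c0 Hc] := mulmx_norm_bound (jac Psi z0)^T.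
have n1 : \forall y \near x0, U y by exact: open_nbhs_nbhs.
have n2 : \forall y \near x0, `|z0 - Phi y| < r / 2.
  have /differentiable_continuous cPhi := dPhi Ux0.
  by move/cvgrPdist_lt : cPhi => /(_ _ r20).
have n3 : \forall y \near x0, forall i j : 'I_N, `|jac Psi (Phi y) i j - jac Psi z0 i j| <= 1.
  have /differentiable_continuous cPhi := dPhi Ux0.
  exact: (cPhi _ (jac_near sPsi Vz0 oV ltr01)).
have [d /= d0 Hd] := (nbhs_ballP _ _).1 (filterI n1 (filterI n2 n3)).
pose K := c + N%:R + 1.
have K0 : 0 < K by rewrite /K ltr_wpDl// addr_ge0// ltW.
exists (Num.min d (r / 2 / K)).
  by rewrite lt_min d0 divr_gt0.
move=> y z; rewrite !lt_min => /andP[yd _] /andP[_ zr].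
have [|Uy [Hy1 Hy2]] := Hd y; first by rewrite -ball_normE /= distrC.
split => //; rewrite -ball_normE /= /tubeinv opprD addrA.
rewrite (le_lt_trans (ler_normB _ _))// (splitr r) ltr_leD//.
have -> : (jac Psi (Phi y))^T = (jac Psi z0)^T + (jac Psi (Phi y) - jac Psi z0)^T.
  by rewrite linearB /= addrC subrK.
rewrite mulmxDr (le_trans (ler_normD _ _))//.
apply: (@le_trans _ _ (K * `|z|)).
  rewrite /K !mulrDl -addrA lerD// (@le_trans _ _ (N%:R * 1 * `|z|))//.
    by apply: mulmx_norm_le => // i j; rewrite !mxE; have := Hy2 j i; rewrite !mxE.
  by rewrite mulr1 lerDl mul1r.
by rewrite mulrC -ler_pdivlMr// ltW.
Qed.

(** Curves in M are fixed by p, so their velocities are fixed by Dp. *)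
Lemma chart_projection_tangent (p : 'rV[R]_N -> 'rV[R]_N) y a :
  (forall y, M y -> p y = y) -> M y -> U y -> differentiable p y -> a *m flat_mx = a ->
  'D_(a *m jac Psi (Phi y)) p y = a *m jac Psi (Phi y).
Proof.
move=> pM My Uy dp aI.
have [VPhi PsiPhi] := PhiK Uy.
pose c (t : R) := Psi (Phi y + t *: a).
have c0 : c 0 = y by rewrite /c scale0r addr0.
have [|dc Dc] := @is_derive_line _ _ _ Psi (Phi y) a 0.
  by rewrite scale0r addr0; exact: dPsi.
have dc0 : differentiable c 0 by apply/derivable1_diffP.
have dpc : differentiable p (c 0) by rewrite c0.
have D1 : 'D_1 c 0 = a *m jac Psi (Phi y).
  by rewrite Dc scale0r addr0 (derive_jac _ (dPsi VPhi)).
rewrite -D1 -[in LHS]c0 -(derive_chain (1 : R) dc0 dpc).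
apply: near_eq_derive; apply: filterS (chart_curve My Uy aI) => t [_ Mt].
exact: pM.
Qed.

(** Both nearest points and points y + z with z normal at y have tubular
    coordinates, close to those of x0 when the data are.  Injectivity of the
    tubular parametrization there makes the coordinates of x a Lipschitz
    function Z of x, to which [smooth_inverse] applies, and identifies y with
    the nearest point of y + z. *)
Theorem chart_local_projection : compact M -> (0 < n)%N ->
  exists O p, local_projection M x0 O p.
Proof.
move=> cM n0.
have nex x : exists y, nearest M x y by apply: nearest_exists => //; exists x0.
have [p Hp] := choice nex.
have Mp x : M (p x) by have [] := Hp x.
have pM y : M y -> p y = y.
  move=> My; have [_ /(_ _ My)] := Hp y.
  rewrite subrr [leRHS]dotvE mul0mx mxE => H.
  have /dotv_eq0/eqP : dotv (y - p y) (y - p y) = 0 by apply/le_anti; rewrite H dotv_ge0.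
  by rewrite subr_eq0 => /eqP.
have [r [K [r0 K0 rdom Hinj Hunit]]] := local_injectivity open_tubedom z0dom tube_smooth jac_tube_unit.
have [e e0 He] := tubeinv_near r0.
pose d := e / (N%:R + 1).
have N1 : 0 < (N%:R + 1 : R) by rewrite ltr_wpDl.
have d0 : 0 < d by rewrite divr_gt0.
pose O := ball x0 d.
pose Z x := tubeinv (p x) (x - p x).
have OP x : O x -> [/\ U (p x), normal_at (p x) (x - p x), ball z0 r (Z x) & tube (Z x) = x].
  move=> Ox; have xd : `|x0 - x| < d by move: Ox; rewrite /O -ball_normE.
  have xp : `|x - p x| <= N%:R * `|x - x0| by exact: (nearest_norm Mx0 (Hp x)).
  have small : (N%:R + 1) * `|x - x0| < e by rewrite mulrC -ltr_pdivlMr// distrC.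
  have H1 : `|x - p x| < e.
    by rewrite (le_lt_trans xp)// (le_lt_trans _ small)// ler_wpM2r// lerDl.
  have H2 : `|p x - x0| < e.
    have -> : p x - x0 = (x - x0) - (x - p x) by rewrite opprB [RHS]addrC addrA subrK.
    rewrite (le_lt_trans (ler_normB _ _))// (le_lt_trans _ small)//.
    by rewrite mulrDl mul1r addrC lerD2r.
  have [Up Bz] := He _ _ H2 H1.
  have nrm := nearest_normal Up (Hp x).
  by split => //; rewrite /Z tubeK// addrC subrK.
have oO : open O by exact: ball_open.
have Ox0 : O x0 by exact: ballxx.
have sZ : smooth_on O Z.
  apply: (smooth_inverse (W := ball z0 r) (E := tube) (K := K)) => //.
  - exact: ball_open.
  - exact: smooth_on_sub rdom tube_smooth.
  - by move=> x /OP[].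
  - by move=> x /OP[].
  - move=> x x' /OP[_ _ bx tx] /OP[_ _ bx' tx'].
    by rewrite -{2}tx -{2}tx'; exact: Hinj.
have pE x : O x -> p x = Psi (Z x *m flat_mx).
  by move=> /OP[Up nrm _ _]; rewrite tubeinv_flat//; have [] := PhiK Up.
have sp : smooth_on O p.
  apply: (smooth_on_eq (f := fun x => Psi (Z x *m flat_mx))) => //.
    by move=> x /[!inE] Ox; rewrite pE.
  apply/smooth_on_rV => // i; apply/smooth_onP => k.
  apply: (@Ck_comp _ _ _ k _ tubedom (entry (fun z => Psi (z *m flat_mx)) i)) => //.
  - by move=> x /OP[_ _ bx _]; exact: rdom.
  - exact: Ck_tube_base.
  - by move=> j; exact/smooth_on_Ck/smooth_entry.
have dp x : O x -> differentiable p x by exact: smooth_on_diff sp.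
have gradA x v : O x -> differentiable (AM M) x /\ 'D_v (AM M) x = dotv v (p x).
  have AME y : dotv y (p y) + (- 1 / 2) * dotv (p y) (p y) = AM M y.
    by rewrite (AM_nearest (Hp y)); field.
  have derive_AM y : O y -> differentiable (AM M) y.
    move=> Oy; rewrite -(funext AME); apply: differentiableD.
      by apply: differentiable_dotv => //; exact: dp.
    by apply: differentiableZ; apply: differentiable_dotv; exact: dp.
  move=> Ox; split; first exact: derive_AM.
  pose f y := AM M y - dotv y (p x).
  have dl y : differentiable (fun y => dotv y (p x)) y by exact: differentiable_dotv.
  have df y : O y -> differentiable f y by move=> Oy; apply: differentiableB => //; exact: derive_AM.
  have : 'D_v f x = 0.
(* The affine function of the supremum that is attained at x supports A at x. *)
    have fmin t : f x <= f (x + t *: v); last by apply: (fermat_line oO Ox df); exact: (filterE _ fmin).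
    rewrite /f dotvDl; have := AM_ge (x + t *: v) cM (Mp x); rewrite (AM_nearest (Hp x)) dotvDl; lra.
  rewrite /f deriveB; [|by apply/diff_derivable/derive_AM|exact: diff_derivable].
  rewrite derive_dotv// derive_id derive_cst [X in _ - (_ + X)]dotvC [X in _ - (_ + X)]dotvE mul0mx [X in _ - (_ + X)]mxE addr0.
  by move/eqP; rewrite subr_eq0 => /eqP.
exists O, p; split => //.
- pose e' := Num.min e (d / 2).
  exists e' => [|y z My ye ze nz]; first by rewrite lt_min e0 divr_gt0.
  move: ye ze; rewrite !lt_min => /andP[ye yd] /andP[ze zd].
  have Oy : O y.
    by rewrite /O -ball_normE /= distrC (lt_trans yd)// ltr_pdivrMr// ltr_pMr// ltr1n.
  have Oyz : O (y + z).
    rewrite /O -ball_normE /= opprD addrA (le_lt_trans (ler_normB _ _))// (splitr d) ltrD//.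
    by rewrite distrC.
  have [Uy By] := He _ _ ye ze.
  have nzy : normal_at y z.
    by move=> a aI; apply: nz; exact: (chart_projection_tangent pM My Uy (dp _ Oy) aI).
  have [Up nrm Bz Et] := OP _ Oyz.
  have EZ : Z (y + z) = tubeinv y z.
    apply/eqP; rewrite -subr_eq0 -normr_le0 (le_trans (Hinj _ _ Bz By))//.
    by rewrite Et tubeK// subrr normr0 mulr0.
  by rewrite pE// EZ tubeinv_flat//; have [] := PhiK Uy.
- pose i0 : 'I_N := lshift m (Ordinal n0).
  have aI : basis_vec i0 *m flat_mx = basis_vec i0 :> 'rV[R]_N.
    apply/flatE/rowP => j; rewrite !mxE eqxx /=.
    by case: eqP => // /eqP; rewrite eq_rlshift.
  exists (basis_vec i0 *m jac Psi (Phi x0)); last exact: (chart_projection_tangent pM Mx0 Ux0 (dp _ Ox0) aI).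
  apply/eqP => w0; have : basis_vec i0 = 0 :> 'rV[R]_N.
    by rewrite -[LHS]mulmx1 -(jac_PsiPhi Ux0) mulmxA w0 mul0mx.
  move/rowP/(_ i0); rewrite basis_vecE eqxx mxE => /eqP; by rewrite oner_eq0.
Qed.
End Chart.

(** * Tensors of partial derivatives *)

Section Tuples.
Context {R : realType} {N : nat}.

Lemma sum_tuple_rcons {I : finType} k (F : seq I -> R) :
  \sum_(t : k.+1.-tuple I) F t = \sum_a \sum_(t : k.-tuple I) F (rcons t a).
Proof.
rewrite pair_bigA /= (reindex (fun p : I * k.-tuple I => rcons_tuple p.2 p.1)) //=.
exists (fun t : k.+1.-tuple I => (last (thead t) t, belast_tuple (thead t) (behead_tuple t))).
  move=> [a t] _ /=; congr pair; first by rewrite last_rcons.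
  apply: val_inj => /=; case: t => [[|b t] ht] //=.
  by rewrite /thead (tnth_nth b) /= belast_rcons.
move=> t _; apply: val_inj => /=; case/tupleP: t => b t.
by rewrite /thead (tnth_nth b) /= -lastI.
Qed.

Lemma Ak_basis (M : set 'rV[R]_N) k x (i : k.-tuple 'I_N) :
  Ak M x (map_tuple basis_vec i) = AM_partial M i x.
Proof.
rewrite /Ak (bigD1 i)//= big1 ?mulr1; last first.
  by move=> j _; rewrite tnth_map basis_vecE eqxx.
rewrite big1 ?addr0// => t tN.
have [j tj] : exists j, tnth t j != tnth i j.
  apply/existsP; rewrite -negb_forall; apply: contraNN tN => /forallP E.
  by apply/eqP/eq_from_tnth => j; apply/eqP/E.
by rewrite (bigD1 j)//= tnth_map basis_vecE (negbTE tj) mul0r mulr0.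
Qed.

Lemma Ak_sqnorm2E (M : set 'rV[R]_N) k x : Ak_sqnorm M k.+2 x =
  \sum_b \sum_a \sum_(t : k.-tuple 'I_N)
    iter_derive (map basis_vec t) ('D_(basis_vec a) ('D_(basis_vec b) (AM M))) x ^+ 2.
Proof.
rewrite /Ak_sqnorm; under eq_bigr do rewrite Ak_basis.
rewrite /AM_partial (sum_tuple_rcons _ (fun t => iter_derive (map basis_vec t) (AM M) x ^+ 2)).
apply: eq_bigr => b _.
rewrite (sum_tuple_rcons _ (fun t => iter_derive (map basis_vec (rcons t b)) (AM M) x ^+ 2)).
by apply: eq_bigr => a _; apply: eq_bigr => t _; rewrite !map_rcons !iter_derive_rcons.
Qed.

Lemma iter_derive_lincomb {V : normedModType R} (O : set V) vs I (r : seq I) (c : I -> R) (g : I -> V -> R) x :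
  open O -> (forall i, smooth_on O (g i)) -> O x ->
  iter_derive vs (fun y => \sum_(i <- r) c i * g i y) x =
  \sum_(i <- r) c i * iter_derive vs (g i) x.
Proof.
move=> oO sg Ox; elim: vs x Ox => //= v vs IH x Ox.
rewrite (derive_eq_on v oO (g := fun y => \sum_(i <- r) c i * iter_derive vs (g i) y)); last first.
- by rewrite inE.
- by move=> y /[!inE]; exact: IH.
have dg i : differentiable (iter_derive vs (g i)) x by exact: sg.
pose S s := fun y => \sum_(i <- s) c i * iter_derive vs (g i) y.
have S0 : S [::] = cst 0 by apply/funext => y; rewrite /S big_nil.
have SS i s : S (i :: s) = (c i *: iter_derive vs (g i)) + S s.
  by apply/funext => y; rewrite /S big_cons.
have ds s : differentiable (S s) x.
  elim: s => [|i s IHs]; first by rewrite S0; exact: differentiable_cst.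
  by rewrite SS; apply: differentiableD => //; exact: differentiableZ.
rewrite -/(S r); elim: r {IH} => [|i r IHr]; first by rewrite S0 derive_cst big_nil.
rewrite SS big_cons -IHr deriveD; [|apply/diff_derivable/differentiableZ|exact: diff_derivable] => //.
by rewrite deriveZ//; exact: diff_derivable.
Qed.

(** D_v^j is the contraction of the j-th derivative tensor with j copies of v:
    Cauchy-Schwarz in each index, starting from the innermost derivative. *)
Lemma iter_derive_power_le (O : set 'rV[R]_N) (g : 'rV[R]_N -> R) normal_vec j x :
  open O -> smooth_on O g -> O x ->
  iter_derive (nseq j normal_vec) g x ^+ 2 <= dotv normal_vec normal_vec ^+ j *
    \sum_(t : j.-tuple 'I_N) iter_derive (map basis_vec t) g x ^+ 2.
Proof.
move=> oO + Ox; elim: j g => [|j IH] g sg.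
  rewrite expr0 mul1r (big_pred1 (nil_tuple _))//= => t; exact/esym/eqP/tuple0.
have -> : nseq j.+1 normal_vec = rcons (nseq j normal_vec) normal_vec by elim: j {IH} => //= j <-.
rewrite iter_derive_rcons.
rewrite (@iter_derive_eq_on _ _ _ O _ (fun y => \sum_i normal_vec 0 i * 'D_(basis_vec i) g y))//; last first.
- by rewrite inE.
- by move=> y /[!inE] Oy; rewrite derive_basis//; exact: smooth_on_diff sg Oy.
rewrite (iter_derive_lincomb _ _ _ oO)//; last by move=> i; exact: smooth_on_derive.
apply: le_trans (cauchy_schwarz_sum _ _) _.
have nu0 : 0 <= dotv normal_vec normal_vec by apply: sumr_ge0 => i _; rewrite -expr2 sqr_ge0.
rewrite [X in X * _ <= _](_ : _ = dotv normal_vec normal_vec) ?exprS -?mulrA ?ler_wpM2l//.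
rewrite (sum_tuple_rcons _ (fun t => iter_derive (map basis_vec t) g x ^+ 2)) mulr_sumr.
apply: ler_sum => i _; rewrite (le_trans (IH _ _))//; first exact: smooth_on_derive.
by under [in leRHS]eq_bigr do rewrite map_rcons iter_derive_rcons.
Qed.
End Tuples.

(** * The second fundamental form as a third derivative *)

Section LocalProjection.
Context {R : realType} {N : nat} (M : set 'rV[R]_N) (x0 : 'rV[R]_N)
    (O : set 'rV[R]_N) (p : 'rV[R]_N -> 'rV[R]_N) (lp : local_projection M x0 O p).
Implicit Types (x y u v w : 'rV[R]_N).

Let oO := lp_open lp.
Let Ox0 := lp_in lp.
Let Mx0 := lp_base lp.

Lemma entry_p_smooth i : smooth_on O (entry p i).
Proof. by have /smooth_on_rV := lp_smooth lp; apply. Qed.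

Lemma dentry_p_smooth v i : smooth_on O ('D_v (entry p i)).
Proof. exact/smooth_on_derive/entry_p_smooth. Qed.

Lemma p_diff x : O x -> differentiable p x.
Proof. exact: smooth_on_diff (lp_smooth lp). Qed.

Lemma derive_p v x : O x -> 'D_v p x = v *m jac p x.
Proof. by move=> Ox; rewrite derive_jac//; exact: p_diff. Qed.

Lemma derive_entry_p v i x : O x -> 'D_v (entry p i) x = (v *m jac p x) 0 i.
Proof. by move=> Ox; rewrite -derive_p// derive_rV//; exact: p_diff. Qed.

Lemma derive_AM b : {in O, 'D_(basis_vec b) (AM M) =1 entry p b}.
Proof.
by move=> x /[!inE] Ox; rewrite (lp_grad lp _ Ox).2 dotvC dotv_basis.
Qed.

Lemma derive2_AM a b : {in O, 'D_(basis_vec a) ('D_(basis_vec b) (AM M)) =1 'D_(basis_vec a) (entry p b)}.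
Proof. exact: derive_eq_on oO (@derive_AM b). Qed.

(** Dp is the Hessian of A^M. *)
Lemma jac_p_sym x : O x -> (jac p x)^T = jac p x.
Proof.
move=> Ox; apply/matrixP => a b; rewrite !mxE.
have Ox' := mem_set Ox.
rewrite -[LHS](@derive2_AM b a x Ox') -[RHS](@derive2_AM a b x Ox').
have dd c : differentiable ('D_(basis_vec c) (AM M)) x.
  apply: (near_eq_differentiable (f := entry p c)); last exact: smooth_on_diff (entry_p_smooth c) Ox.
  by apply: open_eq_near Ox _ => // y yO; rewrite derive_AM.
by apply: (derive_symmetric oO) => // y Oy; exact: (lp_grad lp 0 Oy).1.
Qed.

(** p restricts to the identity on M. *)
Lemma tangent_fix y v : M y -> O y -> tangent M y v -> v *m jac p y = v.
Proof.
move=> My Oy [I [c [[oI I0 sc] [Mc c0 dc]]]].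
rewrite -derive_p// -{1}dc -[in 'D__ p y]c0.
have dfc := smooth_on_diff sc I0.
rewrite -(derive_chain (g := c))//; last by rewrite c0; exact: p_diff.
rewrite -dc; apply: (derive_eq_on _ oI); last by rewrite inE.
by move=> t /[!inE] It; rewrite (lp_fix lp)//; exact: Mc.
Qed.

Lemma open_line y v : open [set t : R | O (y + t *: v)].
Proof.
apply: (@open_comp _ _ (fun t : R => y + t *: v) O) => // t _.
apply: cvgD; first exact: cvg_cst.
by apply: cvgZr_tmp; exact: cvg_id.
Qed.

(** The curve t |-> p (y + t v) stays in M. *)
Lemma jac_p_tangent y v : M y -> O y -> tangent M y (v *m jac p y).
Proof.
move=> My Oy; exists [set t : R | O (y + t *: v)], (fun t => p (y + t *: v)).
have l0 : y + (0 : R) *: v = y by rewrite scale0r addr0.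
split; split.
- exact: open_line.
- by rewrite /= l0.
- apply/smooth_on_rV => [|i]; first exact: open_line.
  apply/smooth_onP => k.
  apply: (@Ck_comp _ _ _ k _ O (entry p i)) => //; first exact: open_line.
    exact/smooth_on_Ck/entry_p_smooth.
  move=> j.
  apply: (@Ck_eq _ _ _ _ (fun t : R => y 0 j + t * v 0 j)).
  + exact: open_line.
  + by move=> t _; rewrite !mxE.
  + apply: Ck_add; [exact: open_line|apply: Ck_cst; exact: open_line|].
    apply: Ck_mul; [exact: open_line| |apply: Ck_cst; exact: open_line].
    case: k => //= k; split => // w.
    apply: (@Ck_eq _ _ _ _ (cst w)); [exact: open_line|by move=> t _; rewrite derive_id|].
    by apply: Ck_cst; exact: open_line.
- by move=> t _; exact: (lp_range lp).
- by rewrite l0 (lp_fix lp).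
- have [|_ ->] := @is_derive_line _ _ _ p y v 0; first by rewrite l0; exact: p_diff.
  by rewrite l0 derive_p.
Qed.

Let P := jac p x0.

Lemma projT_sym : P^T = P. Proof. exact: jac_p_sym. Qed.

Lemma projT_symE a b : P a b = P b a. Proof. by rewrite -{1}projT_sym mxE. Qed.

Lemma projT_idem : P *m P = P.
Proof.
apply/row_matrixP => i; rewrite row_mul rowE.
by apply: tangent_fix => //; exact: jac_p_tangent.
Qed.

(** By the two preceding facts the tangent space is the range of the symmetric
    idempotent P. *)
Lemma tangent_projE v : tangent_proj M x0 v = v *m P.
Proof.
apply: xget_unique => /=.
  split; first exact: jac_p_tangent.
  move=> u tu; have uP := tangent_fix Mx0 Ox0 tu.
  by rewrite dotvBl dotv_mulmx projT_sym uP subrr.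
move=> w [tw w_orth]; apply/eqP; rewrite -subr_eq0; apply/eqP/dotv_eq0.
have wP := tangent_fix Mx0 Ox0 tw.
have td : tangent M x0 (w - v *m P) by rewrite -wP -mulmxBl; exact: jac_p_tangent.
have dP := tangent_fix Mx0 Ox0 td.
have E : w - v *m P = - (v - w) + (v - v *m P) by rewrite opprB addrA subrK.
by rewrite {1}E dotvDl dotvNl w_orth// oppr0 add0r dotvBl dotv_mulmx projT_sym dP subrr.
Qed.

(** Components of A^3 at x0, hence symmetric in all indices. *)
Definition thirdA d a b : R := 'D_(basis_vec d) ('D_(basis_vec a) (entry p b)) x0.

Lemma thirdA_sym12 d a b : thirdA d a b = thirdA a d b.
Proof.
apply: (derive_symmetric oO) => //.
- by move=> y Oy; exact: smooth_on_diff (entry_p_smooth b) Oy.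
- exact: smooth_on_diff (dentry_p_smooth _ b) Ox0.
- exact: smooth_on_diff (dentry_p_smooth _ b) Ox0.
Qed.

Lemma thirdA_sym23 d a b : thirdA d a b = thirdA d b a.
Proof.
apply: (derive_eq_on _ oO); last by rewrite inE.
by move=> x /[!inE] Ox; have := congr1 (fun A : 'M_N => A b a) (jac_p_sym Ox); rewrite !mxE.
Qed.

Lemma derive2_basisr u v b :
  'D_u ('D_v (entry p b)) x0 = \sum_a v 0 a * 'D_u ('D_(basis_vec a) (entry p b)) x0.
Proof.
have -> : 'D_u ('D_v (entry p b)) x0 =
  iter_derive [:: u] (fun y => \sum_a v 0 a * 'D_(basis_vec a) (entry p b) y) x0.
  apply: (derive_eq_on _ oO); last by rewrite inE.
  move=> y /[!inE] Oy; rewrite derive_basis//; exact: smooth_on_diff (entry_p_smooth b) Oy.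
by rewrite (iter_derive_lincomb _ _ _ oO)// => a; exact: dentry_p_smooth.
Qed.

Lemma derive2E u v b : 'D_u ('D_v (entry p b)) x0 = \sum_d \sum_a u 0 d * v 0 a * thirdA d a b.
Proof.
rewrite derive_basis; last exact: smooth_on_diff (dentry_p_smooth _ b) Ox0.
apply: eq_bigr => d _; rewrite derive2_basisr scaler_sumr.
by apply: eq_bigr => a _; rewrite /GRing.scale/= mulrA.
Qed.

(** D_u (D_v p) (x0): the second fundamental form when u and v are tangent. *)
Definition sff_tensor u v : 'rV[R]_N := \row_b 'D_u ('D_v (entry p b)) x0.

(** The identity Y(y) = D_(Y(y)) p (y) on M, differentiated along v at x0, reads
    D_v Y = D_(D_v Y) p + D_v (D_w p), so that D_v (D_w p) is the normal part of
    D_v Y for every extension Y of w.  The value 0 is the default taken without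
    an extension. *)
Lemma sff_tangentE v w : v *m P = v -> w *m P = w ->
  sff_tangent M x0 v w = 0 \/
  (sff_tangent M x0 v w = sff_tensor v w /\ sff_tensor v w *m P = 0).
Proof.
move=> vP wP; rewrite /sff_tangent.
case: xgetP => [b _|_]; last by left.
move=> [Y [[U [oU Ux sY tY]] Yx bE]]; right.
have tv : tangent M x0 v by rewrite -vP; exact: jac_p_tangent.
have [I [c [[oI I0 sc] [Mc c0 dc]]]] := tv.
have dc0 := smooth_on_diff sc I0.
pose Yc i y := Y y 0 i.
have sYc i : smooth_on U (Yc i) by have /smooth_on_rV := sY; apply.
have bsff : b = sff_tensor v w.
  rewrite bE /normal_proj tangent_projE; apply/rowP => j; rewrite !mxE.
  pose G i y := Yc i y * 'D_(basis_vec i) (entry p j) y.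
  have dYc i : differentiable (Yc i) x0 by exact: smooth_on_diff (sYc i) Ux.
  have dpi i : differentiable ('D_(basis_vec i) (entry p j)) x0 by exact: smooth_on_diff (dentry_p_smooth _ j) Ox0.
  have dG i : differentiable (G i) x0 by exact: differentiableM.
  have dS : differentiable (\sum_i G i) x0 by exact: differentiable_sum.
(* This function vanishes on M, in particular along a curve with velocity v. *)
  have E : 'D_v (\sum_i G i - Yc j) x0 = 0.
    rewrite -dc -[in 'D__ _ x0]c0 -(derive_chain (g := c))//; last first.
      by rewrite c0; apply: differentiableB.
    transitivity ('D_(1 : R) (cst (0 : R)) (0 : R)); last exact: derive_cst.
    apply: near_eq_derive.
    have cc : c @ (0 : R) --> c 0 by exact: differentiable_continuous.
    have nU : \forall t \near (0 : R), (U `&` O) (c t).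
      by apply: cc; rewrite c0; apply: open_nbhs_nbhs; split=> //; exact: openI.
    have nI : \forall t \near (0 : R), I t by exact: open_nbhs_nbhs.
    apply: filterS2 nU nI => t [Uct Oct] It.
    have Mct : M (c t) by exact: Mc.
    have := tangent_fix Mct Oct (tY _ Uct Mct).
    move=> /(congr1 (fun A : 'rV_N => A 0 j)); rewrite mxE => E.
    rewrite /cst; apply/eqP; rewrite subr_eq0; apply/eqP.
    rewrite fct_sumE /Yc -[RHS]E; apply: eq_bigr => i _.
    by rewrite /G !mxE.
  move: E; rewrite deriveB; [|exact: diff_derivable|exact: diff_derivable].
  rewrite derive_sum; last by move=> i; exact: diff_derivable.
  move=> /eqP; rewrite subr_eq0 => /eqP E.
  have -> : ('D_v Y x0) 0 j = 'D_v (Yc j) x0.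
    by rewrite derive_rV//; exact: smooth_on_diff sY Ux.
  have {}E : 'D_v (Yc j) x0 = 'D_v ('D_w (entry p j)) x0 + ('D_v Y x0 *m P) 0 j.
    rewrite -E derive2_basisr mxE -big_split; apply: eq_bigr => i _ /=.
    rewrite deriveM; [|exact: diff_derivable|exact: diff_derivable].
    rewrite /GRing.scale/= [X in _ + X]mulrC /Yc Yx !mxE; congr (_ + _ * _).
    by rewrite derive_rV//; exact: smooth_on_diff sY Ux.
  by rewrite E mxE addrK.
rewrite bsff; split => //; rewrite -bsff bE /normal_proj tangent_projE.
by rewrite mulmxBl -mulmxA projT_idem subrr.
Qed.

Definition normal_vec l : 'rV[R]_N := basis_vec l - basis_vec l *m P.
(** The derivative of the Hessian H at x0 in direction v.  For normal v,
    P *m dhess v *m P is the shape operator in that direction. *)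
Definition dhess v : 'M[R]_N := \matrix_(d, a) 'D_v ('D_(basis_vec d) (entry p a)) x0.

Lemma normal_vec_projT l : normal_vec l *m P = 0.
Proof. by rewrite mulmxBl -mulmxA projT_idem subrr. Qed.

Lemma dhessE v d a : dhess v d a = \sum_b v 0 b * thirdA b d a.
Proof. by rewrite mxE derive_basis//; exact: smooth_on_diff (dentry_p_smooth _ a) Ox0. Qed.

Lemma dhess_sym v : (dhess v)^T = dhess v.
Proof.
by apply/matrixP => a b; rewrite mxE !dhessE; apply: eq_bigr => c _; rewrite thirdA_sym23.
Qed.

(** B(e_i, e_j) is normal, so its component along e_l is its scalar product
    with the normal part of e_l, which is an entry of a shape operator. *)
Lemma sff_entry_le i j l :
  dotv (sff M x0 (basis_vec i) (basis_vec j)) (basis_vec l) ^+ 2 <=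
  (P *m dhess (normal_vec l) *m P) i j ^+ 2.
Proof.
rewrite /sff !tangent_projE.
have pp a : basis_vec a *m P *m P = basis_vec a *m P by rewrite -mulmxA projT_idem.
have [->|[-> TP]] := sff_tangentE (pp i) (pp j).
  by rewrite dotvE mul0mx mxE expr0n sqr_ge0.
set T := sff_tensor _ _ in TP *.
have -> : dotv T (basis_vec l) = dotv T (normal_vec l).
  by rewrite [RHS]dotvC dotvBl dotv_mulmx projT_sym TP [X in _ - X]dotvE trmx0 mulmx0 mxE subr0 dotvC.
rewrite [dotv _ _](_ : _ = (P *m dhess (normal_vec l) *m P) i j)//.
rewrite [LHS](_ : _ = \sum_b \sum_d \sum_a normal_vec l 0 b * (P i d * P j a * thirdA b d a)); last first.
  apply: eq_bigr => b _; rewrite mxE derive2E mulr_suml; apply: eq_bigr => d _.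
  rewrite mulr_suml; apply: eq_bigr => a _.
  by rewrite /basis_vec -!rowE [row i P 0 d]mxE [row j P 0 a]mxE thirdA_sym23 thirdA_sym12 mulrC.
rewrite mxE exchange_big /= (eq_bigr (fun d => \sum_a P i d * dhess (normal_vec l) d a * P j a)).
  rewrite exchange_big /=; apply: eq_bigr => a _.
  by rewrite [(P *m dhess _) i a]mxE mulr_suml [P a j]projT_symE.
move=> d _; rewrite exchange_big /=; apply: eq_bigr => a _.
rewrite dhessE mulr_sumr mulr_suml; apply: eq_bigr => b _; ring.
Qed.

Lemma sff_norm_le :
  sff_norm M x0 ^+ 2 <= \sum_l frob2 (P *m dhess (normal_vec l) *m P).
Proof.
rewrite sqr_sqrtr; last by do 3!(apply: sumr_ge0 => ? _); exact: sqr_ge0.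
rewrite [leRHS]exchange_big /=; apply: ler_sum => i _.
rewrite [leRHS]exchange_big /=; apply: ler_sum => j _.
by apply: ler_sum => l _; exact: sff_entry_le.
Qed.

(** For y in M the vector n(y) = v - H(y) v is normal, so y + t n(y) projects
    to y.  With y = p(x) this reads p (p x + t n (p x)) = p x; the claim is its
    derivative in x at x0. *)
Lemma fiber_line v : v *m P = 0 ->
  \forall t \near (0 : R), (P - t *: (P *m dhess v)) *m jac p (x0 + t *: v) = P.
Proof.
move=> vP.
have [e e0 fib] := lp_fiber lp.
pose n y : 'rV[R]_N := \row_i (v 0 i - 'D_v (entry p i) y).
have nE y : O y -> n y = v - v *m jac p y.
  by move=> Oy; apply/rowP => i; rewrite !mxE derive_entry_p// mxE.
have n0 : n x0 = v by rewrite nE// vP subr0.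
have dni i : differentiable (fun y => v 0 i - 'D_v (entry p i) y) x0.
  apply: differentiableB; first exact: differentiable_cst.
  exact: smooth_on_diff (dentry_p_smooth _ i) Ox0.
have dn : differentiable n x0.
  apply/differentiable_rV => i.
  by rewrite (_ : (fun y => n y 0 i) = fun y => v 0 i - 'D_v (entry p i) y)//; apply/funext => y; rewrite mxE.
have Dn u : 'D_u n x0 = - (u *m dhess v).
  apply/rowP => i; rewrite derive_rV//.
  rewrite (_ : (fun y => n y 0 i) = fun y => v 0 i - 'D_v (entry p i) y); last by apply/funext => y; rewrite mxE.
  rewrite deriveB; [|exact: diff_derivable|]; last first.
    by apply: diff_derivable; exact: smooth_on_diff (dentry_p_smooth _ i) Ox0.
  rewrite derive_cst sub0r !mxE; congr (- _).
  rewrite derive_basis; last exact: smooth_on_diff (dentry_p_smooth _ i) Ox0.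
  apply: eq_bigr => d _.
  suff -> : 'D_(basis_vec d) ('D_v (entry p i)) x0 = dhess v d i by [].
  rewrite [RHS]mxE.
  apply: (derive_symmetric oO Ox0).
  - by move=> y Oy; exact: smooth_on_diff (entry_p_smooth i) Oy.
  - exact: smooth_on_diff (dentry_p_smooth _ i) Ox0.
  - exact: smooth_on_diff (dentry_p_smooth _ i) Ox0.
have px0 : p x0 = x0 by exact: (lp_fix lp).
have dp0 := p_diff Ox0.
near=> t.
have Ot : O (x0 + t *: v) by near: t; exact: near_line oO Ox0.
(* The bound is uniform for y near x0, where |n y| < |v| + 1. *)
have te : `|t| * (`|v| + 1) < e.
  have v1 : 0 < `|v| + 1 by rewrite ltr_wpDl.
  rewrite -ltr_pdivlMr//; near: t.
  apply: (@nbhs0_lt R R^o).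
  by apply: divr_gt0 => //; rewrite ltr_wpDl.
pose psi x := p x + t *: n (p x).
have dnp : differentiable (fun x => n (p x)) x0.
  by apply: (@differentiable_comp _ _ _ _ p n) => //; rewrite px0.
have dpsi : differentiable psi x0.
  by apply: differentiableD => //; exact: differentiableZ.
have psi0 : psi x0 = x0 + t *: v by rewrite /psi px0 n0.
have key : \forall x \near x0, p (psi x) = p x.
  have cp : p @ x0 --> p x0 by exact: differentiable_continuous.
  have cn : n (p x) @[x --> x0] --> n (p x0) by exact: (differentiable_continuous dnp).
  rewrite px0 n0 in cn; rewrite px0 in cp.
  have cp1 : \forall x \near x0, `|x0 - p x| < e.
    by move/cvgrPdist_lt : cp => /(_ _ e0).
  have cn1 : \forall x \near x0, `|v - n (p x)| < 1.
    by move/cvgrPdist_lt : cn => /(_ _ ltr01).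
  near=> x.
  have Opx : O (p x).
    by near: x; apply: cp; exact: open_nbhs_nbhs.
  apply: fib.
  - exact: (lp_range lp).
  - rewrite distrC; near: x; exact: cp1.
  - rewrite normrZ (le_lt_trans _ te)// ler_wpM2l//.
    rewrite -[n _](subrK v) (le_trans (ler_normD _ _))// addrC lerD2l distrC.
    by apply: ltW; near: x; exact: cn1.
  - move=> u; rewrite derive_p// => uh.
    by rewrite dotvZl nE// dotvBl dotv_mulmx jac_p_sym// uh subrr mulr0.
apply/row_matrixP => a; rewrite row_mul !rowE -!derive_p// -psi0.
have D1 : 'D_(delta_mx 0 a) psi x0 = delta_mx 0 a *m (P - t *: (P *m dhess v)).
  rewrite /psi deriveD; [|exact: diff_derivable|by apply: diff_derivable; exact: differentiableZ].
  rewrite deriveZ; last exact: diff_derivable.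
  rewrite (derive_chain (g := p))//; last by rewrite px0.
  by rewrite px0 Dn derive_p// mulmxBr -scalemxAr mulmxA scalerN.
rewrite -D1.
have dp1 : differentiable p (psi x0) by rewrite psi0; exact: p_diff.
rewrite -(derive_chain (delta_mx 0 a) dpsi dp1).
exact: (near_eq_derive (delta_mx 0 a) key).
Unshelve. all: by end_near. Qed.
End LocalProjection.

(** * Taylor coefficients along a normal line *)

Section Jets.
Context {R : realType} {V : normedModType R} (O : set V) (x0 v : V).
Hypotheses (oO : open O) (Ox0 : O x0).

Lemma line_step (A B C : V -> R) :
  smooth_on O A -> smooth_on O B -> smooth_on O C ->
  (\forall t \near (0 : R), A (x0 + t *: v) = B (x0 + t *: v) + t * C (x0 + t *: v)) ->
  \forall t \near (0 : R), 'D_v A (x0 + t *: v) =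
    'D_v B (x0 + t *: v) + C (x0 + t *: v) + t * 'D_v C (x0 + t *: v).
Proof.
move=> sA sB sC /near_join H.
have nO := near_line v oO Ox0.
apply: filterS2 H nO => t Ht Ot.
have dA := is_derive_line (smooth_on_diff sA Ot).
have dB := is_derive_line (smooth_on_diff sB Ot).
have dC := is_derive_line (smooth_on_diff sC Ot).
have E := near_eq_derive (1 : R) Ht.
rewrite -(derive_val (is_derive := dA)) E.
have dtC : is_derive t 1 (fun s : R => s * C (x0 + s *: v)) (t *: 'D_v C (x0 + t *: v) + C (x0 + t *: v) *: 1).
  exact: is_deriveM.
have := is_deriveD dB dtC => /(@derive_val _ _ _ _ _ _ _) ->.
by rewrite /GRing.scale/= mulr1 -addrA; congr (_ + _); rewrite addrC.
Qed.

(** Leibniz rule for t G, where only two terms survive at t = 0. *)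
Lemma affine_line_jets (F G : V -> R) (c : R) : smooth_on O F -> smooth_on O G ->
  (\forall t \near (0 : R), F (x0 + t *: v) - t * G (x0 + t *: v) = c) ->
  forall j, iter_derive (nseq j.+1 v) F x0 = j.+1%:R * iter_derive (nseq j v) G x0.
Proof.
move=> sF sG FG j.
have sI (f : V -> R) k : smooth_on O f -> smooth_on O (iter_derive (nseq k v) f).
  by move=> sf; elim: k => //= k IH; exact: smooth_on_derive.
suff : \forall t \near (0 : R), iter_derive (nseq j.+1 v) F (x0 + t *: v) =
    j.+1%:R * iter_derive (nseq j v) G (x0 + t *: v) + t * iter_derive (nseq j.+1 v) G (x0 + t *: v).
  by move=> /nbhs_singleton; rewrite mul0r addr0 scale0r addr0.
have sc : smooth_on O (cst c) by apply/smooth_onP => k; exact: Ck_cst.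
elim: j => [|j IH].
  have /(line_step sF sc sG) : \forall t \near (0 : R), F (x0 + t *: v) = cst c (x0 + t *: v) + t * G (x0 + t *: v).
    by apply: filterS FG => t <-; rewrite subrK.
  by apply: filterS => t /= ->; rewrite derive_cst add0r mul1r.
have sB : smooth_on O (j.+1%:R *: iter_derive (nseq j v) G).
  apply/smooth_onP => k; apply: (@Ck_mul _ _ k O (cst j.+1%:R) (iter_derive (nseq j v) G)) => //; first exact: Ck_cst.
  exact/smooth_on_Ck/sI.
have nO := near_line v oO Ox0.
have := line_step (sI _ j.+1 sF) sB (sI _ j.+1 sG) IH.
apply: filterS2 nO => t Ot /= ->.
rewrite deriveZ; last exact: diff_derivable (smooth_on_diff (sI _ j sG) Ot).
by rewrite /GRing.scale/= -[j.+2]addn1 natrD mulrDl mul1r.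
Qed.
End Jets.

Section Estimate.
Context {R : realType} {N : nat} (M : set 'rV[R]_N) (x0 : 'rV[R]_N)
    (O : set 'rV[R]_N) (p : 'rV[R]_N -> 'rV[R]_N) (lp : local_projection M x0 O p).

Let oO := lp_open lp.
Let Ox0 := lp_in lp.
Let P := jac p x0.

(** The j-th derivative at t = 0 of the Hessian along t |-> x0 + t v. *)
Definition jet v j : 'M[R]_N :=
  \matrix_(a, b) iter_derive (nseq j v) ('D_(basis_vec a) (entry p b)) x0.

Lemma jet0 v : jet v 0 = P.
Proof. by apply/matrixP => a b; rewrite !mxE. Qed.

Lemma jet1 v : jet v 1 = dhess x0 p v.
Proof. by apply/matrixP => a b; rewrite !mxE. Qed.

(** Taylor coefficients of (P - t S) H (x0 + t v) = P with S = P *m dhess v. *)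
Lemma jet_rec v j : v *m P = 0 ->
  P *m jet v j.+1 = j.+1%:R *: (P *m dhess x0 p v *m jet v j).
Proof.
move=> vP; apply/matrixP => a c.
have sD b : smooth_on O ('D_(basis_vec b) (entry p c)) by exact: dentry_p_smooth lp _ _.
pose lc (A : 'M[R]_N) y := \sum_b A a b * 'D_(basis_vec b) (entry p c) y.
have slc A : smooth_on O (lc A).
  apply/smooth_onP => k; apply: Ck_sum => // b; apply: Ck_mul => //; first exact: Ck_cst.
  exact/smooth_on_Ck/sD.
have lcE A vs : iter_derive vs (lc A) x0 = \sum_b A a b * iter_derive vs ('D_(basis_vec b) (entry p c)) x0.
  exact: (iter_derive_lincomb vs _ (A a) oO sD Ox0).
have H : \forall t \near (0 : R), lc P (x0 + t *: v) - t * lc (P *m dhess x0 p v) (x0 + t *: v) = P a c.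
  apply: filterS (fiber_line lp vP) => t /(congr1 (fun A : 'M_N => A a c)).
  rewrite mxE => <-; rewrite /lc mulr_sumr -sumrB; apply: eq_bigr => b _.
  have entryE (A B : 'M[R]_N) : (A - t *: B) a b = A a b - t * B a b by rewrite !mxE.
  rewrite entryE [jac _ _ b c]mxE; ring.
have := affine_line_jets oO Ox0 (slc P) (slc _) H j.
rewrite !lcE => E.
rewrite [LHS]mxE [RHS]mxE [(_ *m jet v j) a c]mxE.
under eq_bigr do rewrite [jet _ _ _ _]mxE.
by rewrite E; congr (_ * _); apply: eq_bigr => b _; rewrite [jet _ _ _ _]mxE.
Qed.

(** The first Taylor coefficient: the tangential rows of dhess v have no normal
    component, so S is the symmetric compression P *m dhess v *m P. *)
Lemma shape_projT v : v *m P = 0 -> P *m dhess x0 p v = P *m dhess x0 p v *m P.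
Proof. by move=> vP; have := jet_rec 0 vP; rewrite jet1 jet0 scale1r. Qed.

(** On the tangent space the Hessian along the normal line is the resolvent
    (1 - t S)^-1. *)
Lemma projT_jet v j : v *m P = 0 ->
  P *m jet v j.+1 = (j.+1)`!%:R *: (P *m dhess x0 p v *m P) ^+ j.+1.
Proof.
move=> vP; elim: j => [|j IH].
  by rewrite [LHS]jet_rec// jet0 expr1.
rewrite [LHS]jet_rec// [in LHS]shape_projT// factS natrM -scalerA; congr (_ *: _).
have XP : P *m dhess x0 p v *m P *m P = P *m dhess x0 p v *m P by rewrite -mulmxA (projT_idem lp).
move: IH XP; move: (P *m dhess x0 p v *m P) (jet v j.+1) => X J IH XP.
have XJ : X *m J = X *m (P *m J) by rewrite mulmxA XP.
by rewrite XJ IH -scalemxAr [in RHS]exprS.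
Qed.

Lemma normal_vec_norm l : dotv (normal_vec x0 p l) (normal_vec x0 p l) <= 1.
Proof.
have -> : dotv (normal_vec x0 p l) (normal_vec x0 p l) = 1 - P l l.
  have orth : dotv (normal_vec x0 p l) (basis_vec l *m P) = 0.
    by rewrite dotvC dotv_mulmx (projT_sym lp) (normal_vec_projT lp) dotvE trmx0 mulmx0 mxE.
  rewrite {1}/normal_vec dotvBl [X in _ - X]dotvC orth subr0 dotvC /normal_vec dotvBl !dotv_basis.
  by rewrite basis_vecE eqxx /basis_vec -rowE [row l _ 0 l]mxE.
rewrite lerBlDr lerDl.
have {1}-> : P = P *m P^T by rewrite (projT_sym lp) (projT_idem lp).
by rewrite mxE; apply: sumr_ge0 => i _; rewrite [P^T i l]mxE -expr2 sqr_ge0.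
Qed.

(** The entries of the jet evaluate A^(j+2) on j copies of a vector of norm at
    most 1 and two basis vectors. *)
Lemma jet_le l j : frob2 (jet (normal_vec x0 p l) j) <= Ak_sqnorm M j.+2 x0.
Proof.
rewrite Ak_sqnorm2E exchange_big /= /frob2.
apply: ler_sum => a _; apply: ler_sum => b _; rewrite mxE.
under [in leRHS]eq_bigr => t _.
  rewrite (iter_derive_eq_on _ oO (derive2_AM lp a b)); last by rewrite inE.
  over.
apply: le_trans (iter_derive_power_le _ _ oO (dentry_p_smooth lp _ _) Ox0) _.
rewrite ler_piMl//; first by apply: sumr_ge0 => t _; exact: sqr_ge0.
by rewrite exprn_ile1// ?normal_vec_norm// dotv_ge0.
Qed.

Lemma shape_sym v : (P *m dhess x0 p v *m P)^T = P *m dhess x0 p v *m P.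
Proof. by rewrite !trmx_mul (projT_sym lp) (dhess_sym lp) mulmxA. Qed.

Lemma shape_power_le l j :
  frob2 ((P *m dhess x0 p (normal_vec x0 p l) *m P) ^+ j.+1) <= N%:R * Ak_sqnorm M j.+3 x0.
Proof.
set S := _ *m P.
have F1 : 1 <= ((j.+1)`!%:R : R) by rewrite ler1n fact_gt0.
apply: (@le_trans _ _ (frob2 (P *m jet (normal_vec x0 p l) j.+1))).
  rewrite (projT_jet _ (normal_vec_projT lp l)) frob2Z ler_peMl ?frob2_ge0//.
  by rewrite exprn_ege1.
apply: le_trans (frob2_mul _ _) _; apply: ler_pM; rewrite ?frob2_ge0//.
  exact: (frob2_proj (projT_sym lp) (projT_idem lp)).
exact: jet_le.
Qed.

(** For k = 2 the projection P on a nonzero space has norm at least 1.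
    Otherwise some normal direction carries a share 1/N of |B|^2. *)
Lemma Ak_ge k : (2 <= k)%N ->
  (N%:R ^+ (2 * k - 4))^-1 * sff_norm M x0 ^+ (2 * k - 4) <= Ak_sqnorm M k x0.
Proof.
case: k => [|[|k]]// _.
have -> : (2 * k.+2 - 4 = 2 * k)%N by rewrite !mulnS; lia.
have Ak0 i : 0 <= Ak_sqnorm M i x0 by apply: sumr_ge0 => t _; exact: sqr_ge0.
case: k => [|k].
  rewrite muln0 !expr0 invr1 mulr1.
  have [w w0 wP] := lp_nontrivial lp; rewrite (derive_p lp _ Ox0) in wP.
  have w2 : 0 < dotv w w.
    by rewrite lt_neqAle dotv_ge0 andbT eq_sym; apply: contra w0 => /eqP/dotv_eq0->.
  have frobw : frob2 w = dotv w w.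
    by rewrite /frob2 big_ord1 /dotv; apply: eq_bigr => i _; rewrite expr2.
  have := frob2_mul w P; rewrite wP frobw ler_pMr// => /le_trans; apply.
  move: w w0 {wP w2 frobw} => w; case: (posnP N) => [N0|N0] w0.
    by case/eqP: w0; apply/rowP => i; have := ltn_ord i; rewrite [X in (_ < X)%N]N0.
  by have := jet_le (Ordinal N0) 0; rewrite jet0.
rewrite [sff_norm M x0 ^+ _]exprM.
have [S0|S0] := leP (\sum_l frob2 (P *m dhess x0 p (normal_vec x0 p l) *m P)) 0.
  have -> : sff_norm M x0 ^+ 2 = 0.
    by apply/le_anti; rewrite (le_trans (sff_norm_le lp) S0) sqr_ge0.
  by rewrite expr0n mulr0.
have [l Hl] := sum_le_card_max S0; rewrite card_ord in Hl.
have N0 : 0 < (N%:R : R) by rewrite ltr0n; exact: leq_ltn_trans (ltn_ord l).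
rewrite ler_pdivrMl ?exprn_gt0//.
have := le_trans (sff_norm_le lp) Hl; move: (sff_norm M x0 ^+ 2) (sqr_ge0 (sff_norm M x0)) => s s0 sl.
have /le_trans : s ^+ k.+1 <= (N%:R * frob2 (P *m dhess x0 p (normal_vec x0 p l) *m P)) ^+ k.+1.
  by rewrite lerXn2r// ?nnegrE// mulr_ge0// frob2_ge0.
apply; rewrite exprMn.
have -> : (2 * k.+1 = k.+1 + k.+1)%N by lia.
rewrite exprD -mulrA ler_pM2l ?exprn_gt0//.
apply: le_trans (frob2_exp_ge k (shape_sym _)) _.
rewrite [N%:R ^+ k.+1]exprSr -mulrA ler_pM2l ?exprn_gt0//; exact: shape_power_le.
Qed.
End Estimate.

Theorem proposition2p6 (R : realType) (n m k : nat) (hn : (1 <= n)%N) (hk : (2 <= k)%N) :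
  exists C : R, 0 < C /\
    forall M : set 'rV[R]_(n + m),
      embedded_submanifold M -> compact M ->
      forall x : 'rV[R]_(n + m), M x ->
        C * sff_norm M x ^+ (2 * k - 4) <= Ak_sqnorm M k x.
Proof.
exists (((n + m)%:R ^+ (2 * k - 4))^-1); split.
  by rewrite invr_gt0 exprn_gt0// ltr0n addn_gt0 hn.
move=> M embM cM x Mx.
have [U [V [Phi [Psi [[oU oV Ux] [[sPhi sPsi PhiK PsiK] flat]]]]]] := embM x Mx.
have [D [p lp]] := chart_local_projection Mx oU oV Ux sPhi sPsi PhiK PsiK flat cM hn.
exact: (Ak_ge lp hk).
Qed.
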